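(* Let $Q:\mathbb{R}_{\ge0}\to\overline{\mathcal Q}_n$ be Riemann-integrable and sufficiently exciting. Then for every connected continuous-time interconnection $\Gamma=[\gamma_{ij}]\in\mathbb{R}^{p\times p}$, the solutions $x_i(\cdot)$ of $\dot x_i=Q_t\sum_{j\ne i}\gamma_{ij}(x_j-x_i)$, $i=1,\dots,p$, synchronize to the constant $\bar x(t)\equiv(r^T\otimes I_n)\mathbf x(0)$, where $\mathbf x=[x_1^T\cdots x_p^T]^T$ and $r\in\mathbb{R}^p$ satisfies $r^T\Gamma=0$, $r^T\mathbf 1=1$.
   Context: $|\cdot|$ induced 2-norm; $\mathbf 1$ all-ones vector; $\otimes$ Kronecker product; $\sigma_{\min}$ smallest singular value; $\mathcal Q_n$ symmetric positive semidefinite $n\times n$ matrices; $\overline{\mathcal Q}_n=\{R\in\mathcal Q_n:|R|\le1\}$. Let $\delta(\varepsilon,T):=\min\{\varepsilon/2,\varepsilon^3/(240T^5)\}$. $Q:\mathbb{R}_{\ge0}\to\mathcal Q_n$ is sufficiently exciting if there is a sequence $(\varepsilon_i,T_i)_{i\ge1}$ of pairs of positive reals with $\sigma_{\min}\big(\int_{t_i}^{t_i+T_i}Q_t\,dt\big)\ge\varepsilon_i$, where $t_1=0$, $t_i=\sum_{j<i}T_j$, and $\sum_{i=1}^\infty\delta(\varepsilon_i,T_i)=\infty$. Continuous-time interconnection: $\gamma_{ij}\ge0$ ($i\ne j$), $\gamma_{ii}=-\sum_{j\ne i}\gamma_{ij}$; graph edge $(n_i,n_j)$ iff $\gamma_{ij}>0$;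 connected if some node is reachable by a directed path from every other node. Synchronize to $\bar x$: $|x_i(t)-\bar x(t)|\to0$ as $t\to\infty$ for all $i$. *)

(* Defs.v *)
From Stdlib Require Import Reals.
From Coquelicot Require Import Coquelicot.
From mathcomp Require Import all_boot all_order all_algebra.
From mathcomp Require Import Rstruct.

Set Implicit Arguments.
Unset Strict Implicit.
Unset Printing Implicit Defensive.

Import GRing.Theory.

Definition vnorm {n : nat} (v : 'cV[R]_n) : R :=
  sqrt (\sum_(k < n) (v k ord0 * v k ord0))%R.

Definition opnorm {n : nat} (A : 'M[R]_n) : Rbar :=
  Lub_Rbar (fun y => exists x : 'cV[R]_n, vnorm x = 1 /\ y = vnorm (A *m x)%R).

Definition sigma_min {n : nat} (A : 'M[R]_n) : Rbar :=
  Glb_Rbar (fun y => exists x : 'cV[R]_n, vnorm x = 1 /\ y = vnorm (A *m x)%R).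

Definition symPSD {n : nat} (A : 'M[R]_n) : Prop :=
  trmx A = A /\ forall v : 'cV[R]_n, 0 <= ((trmx v *m A *m v)%R ord0 ord0).

Definition symPSD_le1 {n : nat} (A : 'M[R]_n) : Prop :=
  symPSD A /\ Rbar_le (opnorm A) (Rbar.Finite R1).

Definition mxRInt {n : nat} (Q : R -> 'M[R]_n) (a b : R) : 'M[R]_n :=
  \matrix_(i < n, j < n) RInt (fun t => Q t i j) a b.

Definition riemann_integrable_on_nonneg {n : nat} (Q : R -> 'M[R]_n) : Prop :=
  forall a b : R, 0 <= a -> a <= b ->
    forall i j : 'I_n, ex_RInt (fun t => Q t i j) a b.

Definition delta (eps T : R) : R :=
  Rmin (eps / 2) (eps ^ 3 / (240 * T ^ 5)).

Definition tseq (T : nat -> R) (k : nat) : R :=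
  (\sum_(j < k) T j)%R.

Definition sufficiently_exciting {n : nat} (Q : R -> 'M[R]_n) : Prop :=
  exists eps T : nat -> R,
    (forall k, 0 < eps k /\ 0 < T k) /\
    (forall k, Rbar_le (Rbar.Finite (eps k))
                 (sigma_min (mxRInt Q (tseq T k) (tseq T k + T k)))) /\
    is_lim_seq (sum_n (fun k => delta (eps k) (T k))) p_infty.

Definition ct_interconnection {p : nat} (G : 'M[R]_p) : Prop :=
  (forall i j : 'I_p, i != j -> 0 <= G i j) /\
  (forall i : 'I_p, G i i = - (\sum_(j < p | j != i) G i j)%R).

Definition ic_edge {p : nat} (G : 'M[R]_p) : rel 'I_p :=
  fun i j => (0 < G i j)%R.

Definition ic_connected {p : nat} (G : 'M[R]_p) : Prop :=
  exists k : 'I_p, forall i : 'I_p, connect (ic_edge G) i k.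

(* x is a solution on [0,+oo) of
     xdot_i = Q_t sum_{j<>i} gamma_ij (x_j - x_i),  i = 1..p,
   in integral (Caratheodory) form with Riemann integrals:
     x_i(t) = x_i(0) + int_0^t Q_s sum_{j<>i} gamma_ij (x_j(s)-x_i(s)) ds. *)
Definition is_consensus_solution {n p : nat} (Q : R -> 'M[R]_n) (G : 'M[R]_p)
    (x : 'I_p -> R -> 'cV[R]_n) : Prop :=
  forall (i : 'I_p) (t : R), 0 <= t -> forall a : 'I_n,
    is_RInt
      (fun s => ((Q s *m (\sum_(j < p | j != i) G i j *: (x j s - x i s))) a ord0)%R)
      0 t (x i t a ord0 - x i 0 a ord0).

(* (r^T (x) I_n) x(0) with x = [x_1^T ... x_p^T]^T, i.e. sum_i r_i x_i(0). *)
Definition kron_avg {n p : nat} (r : 'cV[R]_p) (x0 : 'I_p -> 'cV[R]_n) : 'cV[R]_n :=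
  (\sum_(i < p) r i ord0 *: x0 i)%R.

(* Main.v *)
(** Let [Y] be the [p x n] matrix whose rows are the deviations [x_i - xbar]; then
    [Y' = G Y Q_t] and [r^T Y = 0]. For small [h > 0] the matrix [W = I + h G] is stochastic
    with positive diagonal, and by connectedness some power of it has a positive column, so
    [W^N] tends to [1 r^T]. Hence, for [N] large, the explicit finite sum
    [V = sum_(s < N) |W^s Y|^2] satisfies [V' <= - tr (Y Q_t Y^T) / (2 h)]: the derivative of
    [V] telescopes along powers of [W], and no spectral theory of [G] is needed.

    Let [psi] be the integral of [tr (Y Q_t Y^T)] over [[s, s + T]]. As [|Y'|^2] is at most a
    constant times [tr (Y Q_t Y^T)], [Y] moves by at most [sqrt (C T psi)] in that time, so
    comparing [Y_t] with [Y_s] in the form [Q_t] gives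
    [eps |Y_s|^2 <= tr (Y_s (int Q) Y_s^T) <= (2 + 2 C T^2) psi].
    Thus [V] loses at least a fixed multiple of [delta(eps, T) V], and the divergence of
    [sum delta] forces [V] to tend to [0]. *)

Require Import Defs.
From Stdlib Require Import Reals Lra Classical_Prop.
From Coquelicot Require Import Coquelicot.
From mathcomp Require Import all_boot all_order all_algebra.
From mathcomp Require Import Rstruct.

Set Implicit Arguments.
Unset Strict Implicit.
Unset Printing Implicit Defensive.
Import Order.TTheory GRing.Theory Num.Theory.

(** * Riemann integrals and Lipschitz primitives *)

(** [filterlim_RInt] passes to limits that are uniform on the whole line. Cutting every function to
    [0] outside [[a, b]] turns closeness on the interval into closeness everywhere without changing
    integrability. *)
Lemma ex_RInt_uniform_limit (g : R -> R) (a b : R) :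
  a <= b ->
  (forall eps, 0 < eps -> exists f, ex_RInt f a b /\
     forall t, a <= t <= b -> Rabs (f t - g t) <= eps) ->
  ex_RInt g a b.
Proof.
move=> ab approx.
pose clip (f : R -> R) t := if Rle_dec a t then if Rle_dec t b then f t else 0 else 0.
have clipE f t : a <= t <= b -> clip f t = f t.
  by move=> [ha tb]; rewrite /clip; case: Rle_dec => //= _; case: Rle_dec.
have clip_ext f : ex_RInt f a b <-> ex_RInt (clip f) a b.
  by split; apply: ex_RInt_ext => t; rewrite Rmin_left // Rmax_right // => tab;
     rewrite clipE //; lra.
(* The filter of neighbourhoods of [clip g], traced on the integrable functions. *)
pose U := {f : R -> R | ex_RInt f a b}.
pose near (P : U -> Prop) := exists eps : posreal, forall f : U,
  (forall t, Rabs (sval f t - clip g t) < eps) -> P f.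
have near_proper : ProperFilter near.
  split.
    move=> P [eps Peps].
    have [f [intf fg]] := approx (eps / 2) (is_pos_div_2 eps).
    have intcf : ex_RInt (clip f) a b by apply: (proj1 (clip_ext f)).
    exists (exist _ (clip f) intcf); apply: Peps => t /=.
    have e0 := is_pos_div_2 eps; have e1 := cond_pos eps.
    case: (Rle_dec a t) => ha; last first.
      by rewrite /clip; case: Rle_dec => //= _; rewrite Rminus_0_r Rabs_R0.
    case: (Rle_dec t b) => tb; last first.
      by rewrite /clip; case: Rle_dec => //= _; case: Rle_dec => //= _;
         rewrite Rminus_0_r Rabs_R0.
    by rewrite !clipE //; have := fg t (conj ha tb); lra.
  split.
  - by exists (mkposreal 1 Rlt_0_1).
  - move=> P P' [e1 h1] [e2 h2].
    have e0 : 0 < Rmin e1 e2 by apply: Rmin_glb_lt; apply: cond_pos.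
    exists (mkposreal _ e0) => f hf.
    by split; [apply: h1 | apply: h2] => t; apply: Rlt_le_trans (hf t) _;
       [apply: Rmin_l | apply: Rmin_r].
  - by move=> P P' PP' [e h]; exists e => f hf; apply/PP'/h.
have [] := @filterlim_RInt U R_CompleteNormedModule (fun f => sval f) a b near
  near_proper (clip g) (fun f => RInt (sval f) a b).
- by case=> f intf /=; apply: RInt_correct.
- by move=> P [eps Peps]; exists eps => f hf; apply: Peps.
- by move=> If [_ intg]; apply: (proj2 (clip_ext g)); exists If.
Qed.

Definition lipschitz_on (g : R -> R) (a b L : R) : Prop :=
  forall s t, a <= s -> s <= t -> t <= b -> Rabs (g t - g s) <= L * (t - s).

Lemma ex_RInt_bounded (u : R -> R) (a b : R) : a <= b -> ex_RInt u a b ->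
  exists M, 0 < M /\ forall t, a <= t <= b -> Rabs (u t) <= M.
Proof.
move=> ab /ex_RInt_ub[M]; rewrite Rmin_left // Rmax_right // => uM.
exists (Rabs M + 1); split; first by have := Rabs_pos M; lra.
by move=> t /uM uMt; apply: Rle_trans uMt _; have := Rle_abs M; lra.
Qed.

Lemma ex_RInt_sub (u : R -> R) (a b c d : R) :
  a <= c -> c <= d -> d <= b -> ex_RInt u a b -> ex_RInt u c d.
Proof.
move=> ac cd db intu; apply: (@ex_RInt_Chasles_2 _ _ a) => //.
by apply: (@ex_RInt_Chasles_1 _ _ _ _ b) intu; lra.
Qed.

(** [h] is a step function, equal on each short cell to the value of [g] at the right end; [u * h]
    is then a multiple of [u] on each cell. *)
Lemma ex_RInt_mult_step_approx (u g : R -> R) (a b L eps : R) :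
  a <= b -> ex_RInt u a b -> 0 <= L -> lipschitz_on g a b L -> 0 < eps ->
  exists h, ex_RInt (fun t => u t * h t) a b /\
    forall t, a <= t <= b -> Rabs (h t - g t) <= eps.
Proof.
move=> ab intu L0 lipg eps0.
have [d [d0 Ld]] : exists d, 0 < d /\ L * d <= eps.
  (* The [+ 1] covers [L = 0]. *)
  exists (eps / (L + 1)); split; first by apply: Rdiv_lt_0_compat; lra.
  have -> : L * (eps / (L + 1)) = eps - eps / (L + 1) by field; lra.
  suff : 0 < eps / (L + 1) by lra.
  by apply: Rdiv_lt_0_compat; lra.
(* Induction on the number [k] of cells of length [d] needed to cover [[a, c]]. *)
suff main k : forall c, a <= c <= b -> c - a <= INR k * d ->
    exists h, ex_RInt (fun t => u t * h t) a c /\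
      forall t, a <= t <= c -> Rabs (h t - g t) <= eps.
  have [k hk] := INR_unbounded ((b - a) / d).
  apply: (main k) => //; first lra.
  have := Rmult_lt_compat_r d _ _ d0 hk.
  by rewrite (_ : (b - a) / d * d = b - a); [lra | field; lra].
elim: k => [|k IH] c acb.
  rewrite Rmult_0_l => ca; have -> : c = a by lra.
  exists g; split; first exact: ex_RInt_point.
  by move=> t tE; rewrite Rminus_diag Rabs_R0; lra.
rewrite S_INR => ck.
pose c' := Rmax a (c - d).
have ac' : a <= c' by apply: Rmax_l.
have cc' : c - d <= c' by apply: Rmax_r.
have c'c : c' <= c by apply: Rmax_lub; lra.
have [|h [inth hg]] := IH c' (conj ac' (Rle_trans _ _ _ c'c (proj2 acb))).
  have kd : 0 <= INR k * d by apply: Rmult_le_pos; [apply: pos_INR | lra].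
  by rewrite /c'; apply: (Rmax_case _ _ (fun m => m - a <= INR k * d)); lra.
exists (fun t => if Rle_dec t c' then h t else g c); split; last first.
  move=> t tE; case: Rle_dec => /= tc'; first by apply: hg; lra.
  apply: Rle_trans (lipg t c _ _ _) _; try lra.
  by apply: Rle_trans Ld; apply: Rmult_le_compat_l => //; lra.
apply: (@ex_RInt_Chasles_0 _ _ _ c'); first lra.
  apply: ex_RInt_ext inth => t; rewrite Rmin_left // Rmax_right // => tE.
  by case: Rle_dec => //= ?; lra.
apply: (ex_RInt_ext (fun t => scal (g c) (u t))).
  move=> t; rewrite Rmin_left // Rmax_right // => tE.
  by case: Rle_dec => /= [?|_]; [lra | rewrite Rmult_comm].
by apply: ex_RInt_scal; apply: ex_RInt_sub intu; lra.
Qed.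

(** Uniform limit of the products [u * h]. The products met below pair an integrable factor with a
    primitive, and primitives are Lipschitz. *)
Lemma ex_RInt_mult_lipschitz (u g : R -> R) (a b L : R) :
  a <= b -> ex_RInt u a b -> 0 <= L -> lipschitz_on g a b L ->
  ex_RInt (fun t => u t * g t) a b.
Proof.
move=> ab intu L0 lipg; apply: ex_RInt_uniform_limit => // eps eps0.
have [M [M0 uM]] := ex_RInt_bounded ab intu.
have eM : 0 < eps / M by apply: Rdiv_lt_0_compat.
have [h [inth hg]] := ex_RInt_mult_step_approx ab intu L0 lipg eM.
exists (fun t => u t * h t); split=> // t tE.
rewrite -Rmult_minus_distr_l Rabs_mult (_ : eps = M * (eps / M)); last by field; lra.
by apply: Rmult_le_compat; try apply: Rabs_pos; [apply: uM | apply: hg].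
Qed.

(** Over [N] equal pieces the increments add up to at most [C (b - a)^2 / N], which tends to [0].
    This replaces the vanishing of a derivative. *)
Lemma eq_of_quadratic_modulus (D : R -> R) (a b C : R) : a <= b ->
  (forall s t, a <= s -> s <= t -> t <= b -> Rabs (D t - D s) <= C * (t - s) ^ 2) ->
  D b = D a.
Proof.
move=> ab hD.
have sub N k : (0 < N)%N -> (k <= N)%N ->
    Rabs (D (a + INR k * ((b - a) / INR N)) - D a) <= INR k * (C * ((b - a) / INR N) ^ 2).
  move=> N0; have N0' : 0 < INR N by apply/lt_0_INR/ssrnat.ltP.
  have d0 : 0 <= (b - a) / INR N by apply: Rdiv_le_0_compat; lra.
  have dN : INR N * ((b - a) / INR N) = b - a by field; lra.
  set d := (b - a) / INR N in d0 dN *.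
  elim: k => [|k IH] kN.
    by rewrite !Rmult_0_l Rplus_0_r Rminus_diag Rabs_R0; lra.
  have kN' : INR k.+1 <= INR N by apply/le_INR/ssrnat.leP.
  rewrite S_INR in kN' *.
  have k0 := pos_INR k.
  have e1 : (INR k + 1) * d <= INR N * d by apply: Rmult_le_compat_r.
  have e2 : 0 <= INR k * d by apply: Rmult_le_pos.
  have := hD (a + INR k * d) (a + (INR k + 1) * d) ltac:(lra) ltac:(lra) ltac:(lra).
  rewrite (_ : a + (INR k + 1) * d - (a + INR k * d) = d); last ring.
  have := IH (ltnW kN).
  have := Rabs_triang (D (a + (INR k + 1) * d) - D (a + INR k * d)) (D (a + INR k * d) - D a).
  rewrite (_ : D (a + (INR k + 1) * d) - D (a + INR k * d) + (D (a + INR k * d) - D a) =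
    D (a + (INR k + 1) * d) - D a); last ring.
  lra.
apply: Rminus_diag_uniq; apply: Rabs_eq_0; apply: Rle_antisym; last exact: Rabs_pos.
apply: le_epsilon => eps eps0; rewrite Rplus_0_l.
have [N hN] := INR_unbounded (Rabs C * (b - a) ^ 2 / eps).
have N0 : 0 < INR N.
  apply: Rle_lt_trans hN; apply: Rdiv_le_0_compat => //.
  by apply: Rmult_le_pos; [apply: Rabs_pos | apply: pow2_ge_0].
have N0' : (0 < N)%N by apply/ssrnat.ltP/INR_lt.
have := sub N N N0' (leqnn N).
rewrite (_ : a + INR N * ((b - a) / INR N) = b); last by field; lra.
rewrite (_ : INR N * (C * ((b - a) / INR N) ^ 2) = C * (b - a) ^ 2 / INR N); last by field; lra.
move=> h; apply: Rle_trans h _.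
apply: (Rmult_le_reg_r (INR N)) => //.
rewrite (_ : C * (b - a) ^ 2 / INR N * INR N = C * (b - a) ^ 2); last by field; lra.
have : Rabs C * (b - a) ^ 2 / eps * eps = Rabs C * (b - a) ^ 2 by field; lra.
have : Rabs C * (b - a) ^ 2 / eps * eps < INR N * eps by apply: Rmult_lt_compat_r.
have : C * (b - a) ^ 2 <= Rabs C * (b - a) ^ 2.
  by apply: Rmult_le_compat_r; [apply: pow2_ge_0 | apply: Rle_abs].
lra.
Qed.

(** Integral form of [f' = u]: where [u] is discontinuous, [f] may fail to be differentiable. *)
Definition primitive_on (u f : R -> R) (a b : R) : Prop :=
  forall s t, a <= s -> s <= t -> t <= b -> is_RInt u s t (f t - f s).

Lemma primitive_lipschitz (u f : R -> R) (a b M : R) :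
  primitive_on u f a b -> (forall t, a <= t <= b -> Rabs (u t) <= M) ->
  lipschitz_on f a b M.
Proof.
move=> prim uM s t hs st tb.
have hI := prim _ _ hs st tb.
rewrite -(is_RInt_unique _ _ _ _ hI) Rmult_comm.
apply: abs_RInt_le_const => //; first by exists (f t - f s).
by move=> r rE; apply: uM; lra.
Qed.

(* The defect [f g - int (u g + f v)] has increments of order [(t - s)^2]. *)
Lemma primitive_mult (u v f g : R -> R) (a b : R) : a <= b ->
  primitive_on u f a b -> primitive_on v g a b ->
  primitive_on (fun s => u s * g s + f s * v s) (fun t => f t * g t) a b.
Proof.
move=> ab primf primg.
have intu : ex_RInt u a b by exists (f b - f a); apply: primf; lra.
have intv : ex_RInt v a b by exists (g b - g a); apply: primg; lra.
have [M [M0 uM]] := ex_RInt_bounded ab intu.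
have [K [K0 vK]] := ex_RInt_bounded ab intv.
have lipf := primitive_lipschitz primf uM.
have lipg := primitive_lipschitz primg vK.
pose w s := u s * g s + f s * v s.
have intw : ex_RInt w a b.
  apply: (@ex_RInt_plus R_NormedModule).
    by apply: ex_RInt_mult_lipschitz lipg => //; lra.
  apply: (ex_RInt_ext (fun t => v t * f t)); first by move=> t _; rewrite Rmult_comm.
  by apply: ex_RInt_mult_lipschitz lipf => //; lra.
move=> s t hs st tb.
have intws : ex_RInt w s t by apply: ex_RInt_sub intw; lra.
suff -> : f t * g t - f s * g s = RInt w s t by apply: RInt_correct.
pose D r := f r * g r - RInt w s r.
suff : D t = D s by rewrite /D RInt_point /zero /=; lra.
apply: (@eq_of_quadratic_modulus _ _ _ (2 * M * K)) => // p q sp pq qt.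
have Iu : is_RInt u p q (f q - f p) by apply: primf; lra.
have Iv : is_RInt v p q (g q - g p) by apply: primg; lra.
have Iw : is_RInt w p q (RInt w p q) by apply: RInt_correct; apply: ex_RInt_sub intw; lra.
have chasles : RInt w s q = RInt w s p + RInt w p q.
  by rewrite -(RInt_Chasles w s p q) //; apply: ex_RInt_sub intw; lra.
(* The increment of [f g] is split as [g q (f q - f p) + f p (g q - g p)]. With [w] subtracted, the
   integrand at [r] is [u r (g q - g r) - v r (f r - f p)], of order [q - p]. *)
have I1 := is_RInt_minus _ _ _ _ _ _
  (is_RInt_plus _ _ _ _ _ _ (is_RInt_scal _ _ _ (g q) _ Iu) (is_RInt_scal _ _ _ (f p) _ Iv)) Iw.
have -> : D q - D p = RInt (fun r => minus (plus (scal (g q) (u r)) (scal (f p) (v r))) (w r)) p q.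
  rewrite (is_RInt_unique _ _ _ _ I1) /D chasles /minus /plus /Hierarchy.opp /scal /= /mult /=; ring.
rewrite (_ : 2 * M * K * (q - p) ^ 2 = (q - p) * (2 * M * K * (q - p))); last ring.
apply: abs_RInt_le_const => //; first by eexists; exact: I1.
move=> r rE; rewrite /minus /plus /Hierarchy.opp /scal /= /mult /= /w.
have -> : g q * u r + f p * v r + - (u r * g r + f r * v r) =
  u r * (g q - g r) + v r * - (f r - f p) by ring.
apply: Rle_trans (Rabs_triang _ _) _; rewrite !Rabs_mult Rabs_Ropp.
have ur : Rabs (u r) <= M by apply: uM; lra.
have vr : Rabs (v r) <= K by apply: vK; lra.
have gr : Rabs (g q - g r) <= K * (q - p).
  apply: Rle_trans (lipg _ _ _ _ _) _; try lra.
  by apply: Rmult_le_compat_l; lra.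
have fr : Rabs (f r - f p) <= M * (q - p).
  apply: Rle_trans (lipf _ _ _ _ _) _; try lra.
  by apply: Rmult_le_compat_l; lra.
have := Rmult_le_compat _ _ _ _ (Rabs_pos _) (Rabs_pos _) ur gr.
have := Rmult_le_compat _ _ _ _ (Rabs_pos _) (Rabs_pos _) vr fr.
lra.
Qed.

(** * The rate [delta] and its divergent series *)

(** These bounds yield [delta (2 + 2 C T^2) <= (1 + C) eps]. For [T <= 1] the first term of the
    minimum suffices; for [T > 1], with [z = eps / T <= 1], the second one times [T^2] is
    [z^3 / 240]. *)
Lemma delta_bounds (eps T : R) : 0 < eps -> 0 < T ->
  0 <= delta eps T /\ (eps <= T -> delta eps T <= eps / 2 /\ delta eps T * T ^ 2 <= eps / 2).
Proof.
move=> eps0 T0; split.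
  apply: Rmin_glb; first lra.
  by apply: Rlt_le; apply: Rdiv_lt_0_compat; [apply: pow_lt | apply: Rmult_lt_0_compat;
     [lra | apply: pow_lt]].
move=> epsT; have d1 : delta eps T <= eps / 2 by apply: Rmin_l.
split=> //; case: (Rle_lt_dec T 1) => T1.
  have T2 : T ^ 2 <= 1 by rewrite -(pow1 2); apply: pow_incr; lra.
  apply: Rle_trans (_ : eps / 2 * T ^ 2 <= _); last first.
    by rewrite -[X in _ <= X]Rmult_1_r; apply: Rmult_le_compat_l; lra.
  by apply: Rmult_le_compat_r; first exact: pow2_ge_0.
have [z [epsE [z0 z1]]] : exists z, eps = z * T /\ 0 < z /\ z <= 1.
  exists (eps / T); split; first by field; lra.
  split; first exact: Rdiv_lt_0_compat.
  by apply: (Rmult_le_reg_r T) => //; rewrite /Rdiv Rmult_assoc Rinv_l; lra.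
have d2 : delta eps T * T ^ 2 <= z ^ 3 / 240.
  have -> : z ^ 3 / 240 = eps ^ 3 / (240 * T ^ 5) * T ^ 2 by rewrite epsE; field; lra.
  by apply: Rmult_le_compat_r; [exact: pow2_ge_0 | exact: Rmin_r].
apply: Rle_trans d2 _; rewrite epsE.
have : z * z <= 1 by rewrite -(Rmult_1_r 1); apply: Rmult_le_compat; lra.
have : z * 1 <= z * T by apply: Rmult_le_compat_l; lra.
move=> h1 h2; have : z * (z * z) <= z * 1 by apply: Rmult_le_compat_l; lra.
rewrite /=; lra.
Qed.

(** If [v] stayed above [eta], telescoping would bound [eta] times every partial sum of [d] by
    [B * v 0]. *)
Lemma exists_small_of_divergent_decrease (v d : nat -> R) (B : R) :
  0 <= B -> (forall k, 0 <= v k) -> (forall k, 0 <= d k) ->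
  (forall k, d k * v k <= B * (v k - v k.+1)) ->
  is_lim_seq (sum_n d) p_infty ->
  forall eta, 0 < eta -> exists k, v k < eta.
Proof.
move=> B0 v0 d0 decr /is_lim_seq_spec lim eta eta0.
apply: NNPP => no.
have big k : eta <= v k by apply: Rnot_lt_le => vk; apply: no; exists k.
have dk k : eta * d k <= B * (v k - v k.+1).
  apply: Rle_trans (decr k); rewrite Rmult_comm.
  by apply: Rmult_le_compat_l.
have sum m : eta * sum_n d m <= B * (v 0%N - v m.+1).
  elim: m => [|m IH]; first by rewrite sum_O.
  rewrite sum_Sn /plus /= Rmult_plus_distr_l; have := dk m.+1; lra.
have [m hm] := lim (B * v 0%N / eta).
have := hm m (le_n _).
have : B * v 0%N / eta * eta = B * v 0%N by field; lra.
have := sum m; have : 0 <= B * v m.+1 by apply: Rmult_le_pos.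
move=> h1 h2 h3 h4.
have : B * v 0%N / eta * eta < sum_n d m * eta by apply: Rmult_lt_compat_r.
lra.
Qed.

Lemma primitive_on_of_origin (u f : R -> R) (b : R) :
  (forall t, 0 <= t -> is_RInt u 0 t (f t - f 0)) -> primitive_on u f 0 b.
Proof.
move=> prim s t s0 st tb.
have := is_RInt_Chasles _ _ _ _ _ _ (is_RInt_swap _ _ _ _ (prim s s0)) (prim t (Rle_trans _ _ _ s0 st)).
rewrite /Hierarchy.plus /Hierarchy.opp /=.
by rewrite (_ : - (f s - f 0) + (f t - f 0) = f t - f s) //; ring.
Qed.

From mathcomp Require Import ring lra.
Local Open Scope ring_scope.

(** * Positive semidefinite forms *)

(** The form of [Q] summed over matching rows of [A] and [B]; each agent occupies one row. *)
Definition qb (F : realFieldType) (p n : nat) (Q : 'M[F]_n) (A B : 'M[F]_(p, n)) : F :=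
  \tr (A *m Q *m B^T).

Definition psd (F : realFieldType) (n : nat) (Q : 'M[F]_n) : Prop :=
  Q^T = Q /\ forall v : 'cV[F]_n, 0 <= (v^T *m Q *m v) ord0 ord0.

Definition fnorm2 (F : realFieldType) (p n : nat) (A : 'M[F]_(p, n)) : F :=
  \sum_i \sum_j A i j ^+ 2.

Section QuadraticForms.
Variable F : realFieldType.

Lemma qbE (p n : nat) (Q : 'M[F]_n) (A B : 'M[F]_(p, n)) :
  qb Q A B = \sum_i \sum_b \sum_a A i a * Q a b * B i b.
Proof.
apply: eq_bigr => i _; rewrite mxE; apply: eq_bigr => b _.
by rewrite !mxE mulr_suml.
Qed.

Lemma qbDl (p n : nat) (Q : 'M[F]_n) (A B C : 'M[F]_(p, n)) :
  qb Q (A + B) C = qb Q A C + qb Q B C.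
Proof. by rewrite /qb !mulmxDl linearD. Qed.

Lemma qbDr (p n : nat) (Q : 'M[F]_n) (A B C : 'M[F]_(p, n)) :
  qb Q C (A + B) = qb Q C A + qb Q C B.
Proof. by rewrite /qb [(A + B)^T]linearD /= mulmxDr linearD. Qed.

Lemma qbZl (p n : nat) (Q : 'M[F]_n) (c : F) (A B : 'M[F]_(p, n)) :
  qb Q (c *: A) B = c * qb Q A B.
Proof. by rewrite /qb -!scalemxAl linearZ. Qed.

Lemma qbZr (p n : nat) (Q : 'M[F]_n) (c : F) (A B : 'M[F]_(p, n)) :
  qb Q A (c *: B) = c * qb Q A B.
Proof. by rewrite /qb [(c *: B)^T]linearZ /= -scalemxAr linearZ. Qed.

Lemma qbC (p n : nat) (Q : 'M[F]_n) (A B : 'M[F]_(p, n)) :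
  Q^T = Q -> qb Q A B = qb Q B A.
Proof. by move=> QT; rewrite /qb -mxtrace_tr !trmx_mul trmxK QT mulmxA. Qed.

Lemma qb_mulmxl (p q n : nat) (Q : 'M[F]_n) (E : 'M[F]_(q, p))
    (A : 'M[F]_(p, n)) (B : 'M[F]_(q, n)) :
  qb Q (E *m A) B = qb Q A (E^T *m B).
Proof. by rewrite /qb trmx_mul trmxK -!mulmxA mxtrace_mulC !mulmxA. Qed.

Lemma qb_row (p n : nat) (Q : 'M[F]_n) (A : 'M[F]_(p, n)) :
  qb Q A A = \sum_i qb Q (row i A) (row i A).
Proof.
rewrite qbE; apply: eq_bigr => i _; rewrite qbE big_ord1.
by apply: eq_bigr => b _; apply: eq_bigr => a _; rewrite !mxE.
Qed.

Lemma qb_row_ge0 (n : nat) (Q : 'M[F]_n) (v : 'rV[F]_n) : psd Q -> 0 <= qb Q v v.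
Proof. by case=> _ /(_ v^T); rewrite trmxK /qb /mxtrace big_ord1. Qed.

Lemma qb_ge0 (p n : nat) (Q : 'M[F]_n) (A : 'M[F]_(p, n)) : psd Q -> 0 <= qb Q A A.
Proof. by move=> psdQ; rewrite qb_row; apply: sumr_ge0 => i _; apply: qb_row_ge0. Qed.

Lemma fnorm2_ge0 (p n : nat) (A : 'M[F]_(p, n)) : 0 <= fnorm2 A.
Proof. by apply: sumr_ge0 => i _; apply: sumr_ge0 => j _; apply: sqr_ge0. Qed.

Lemma fnorm2_tr (p n : nat) (A : 'M[F]_(p, n)) : fnorm2 A^T = fnorm2 A.
Proof.
by rewrite /fnorm2 exchange_big; apply: eq_bigr => i _; apply: eq_bigr => j _; rewrite mxE.
Qed.

Lemma fnorm2_qb (p n : nat) (A : 'M[F]_(p, n)) : fnorm2 A = qb 1%:M A A.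
Proof.
rewrite /qb mulmx1; apply: eq_bigr => i _; rewrite mxE.
by apply: eq_bigr => j _; rewrite mxE expr2.
Qed.

Lemma psd1 (n : nat) : psd (1%:M : 'M[F]_n).
Proof.
split=> [|v]; first exact: trmx1.
by rewrite mulmx1 mxE; apply: sumr_ge0 => i _; rewrite mxE -expr2 sqr_ge0.
Qed.

Lemma entry_le_fnorm2 (p n : nat) (A : 'M[F]_(p, n)) i j : A i j ^+ 2 <= fnorm2 A.
Proof.
rewrite /fnorm2 (bigD1 i) //= (bigD1 j) //= -addrA lerDl addr_ge0 //.
  by apply: sumr_ge0 => k _; apply: sqr_ge0.
by apply: sumr_ge0 => l _; apply: sumr_ge0 => k _; apply: sqr_ge0.
Qed.

(** Cauchy-Schwarz for the semidefinite form, applied to the combination of the rows of [Y] with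
    weights [e]. *)
Lemma qb_rowmul_le (p n : nat) (Q : 'M[F]_n) (e : 'rV[F]_p) (Y : 'M[F]_(p, n)) :
  psd Q -> qb Q (e *m Y) (e *m Y) <= fnorm2 e * qb Q Y Y.
Proof.
move=> psdQ; have [QT _] := psdQ.
have [s0|s_neq0] := eqVneq (fnorm2 e) 0.
  suff -> : e = 0 by rewrite mul0mx /qb !mul0mx linear0 mulr_ge0 ?qb_ge0 ?fnorm2_ge0.
  apply/matrixP => i j; apply/eqP; rewrite mxE -sqrf_eq0 eq_le sqr_ge0 andbT.
  by rewrite -s0 entry_le_fnorm2.
have s_gt0 : 0 < fnorm2 e by rewrite lt0r s_neq0 fnorm2_ge0.
set s := fnorm2 e in s_neq0 s_gt0 *; move wE : (e *m Y) => w.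
have ee : e *m e^T = s%:M.
  apply/matrixP => i j; rewrite !ord1 !mxE /s /fnorm2 big_ord1 eqxx mulr1n.
  by apply: eq_bigr => k _; rewrite mxE expr2.
have b1 : qb Q (e^T *m w) Y = qb Q w w by rewrite qb_mulmxl trmxK wE.
have b2 : qb Q (e^T *m w) (e^T *m w) = s * qb Q w w.
  by rewrite qb_mulmxl trmxK mulmxA ee mul_scalar_mx qbZr.
(* Nonnegativity of the form at the residual [Y - s^-1 e^T (e Y)]. *)
have h := qb_ge0 (Y + (- s^-1) *: (e^T *m w)) psdQ.
rewrite !qbDl !qbDr !qbZl !qbZr (qbC Y _ QT) b2 b1 in h.
have {}h : 0 <= qb Q Y Y - s^-1 * qb Q w w.
  by apply: le_trans h _; rewrite le_eqVlt; apply/orP; left; apply/eqP; field.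
by move: h; rewrite subr_ge0 mulrC ler_pdivrMr // mulrC.
Qed.

(** The factor is independent of [Q], so one mixing matrix contracts all the forms [Q_t] at once. *)
Lemma qb_mulmx_le (p q n : nat) (Q : 'M[F]_n) (E : 'M[F]_(q, p)) (Y : 'M[F]_(p, n)) :
  psd Q -> qb Q (E *m Y) (E *m Y) <= fnorm2 E * qb Q Y Y.
Proof.
move=> psdQ; rewrite qb_row /fnorm2 mulr_suml; apply: ler_sum => i _.
rewrite row_mul; apply: le_trans (qb_rowmul_le _ _ psdQ) _.
rewrite ler_wpM2r ?qb_ge0 // /fnorm2 big_ord1.
by under eq_bigr do rewrite mxE.
Qed.

Lemma fnorm2_mulmx_le (p q n : nat) (E : 'M[F]_(q, p)) (Y : 'M[F]_(p, n)) :
  fnorm2 (E *m Y) <= fnorm2 E * fnorm2 Y.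
Proof.
by rewrite (fnorm2_qb (E *m Y)) (fnorm2_qb Y); apply/qb_mulmx_le/psd1.
Qed.

Lemma qb_le_double (p n : nat) (Q : 'M[F]_n) (A B : 'M[F]_(p, n)) :
  psd Q -> qb Q A A <= 2 * qb Q B B + 2 * qb Q (A - B) (A - B).
Proof.
move=> psdQ; have [QT _] := psdQ.
(* Nonnegativity of the form at [A - 2 B]. *)
have := qb_ge0 (A + (- 2) *: B) psdQ; rewrite -scaleN1r.
rewrite !qbDl !qbDr !qbZl !qbZr (qbC B A QT); lra.
Qed.

(* [W^(s+1) Y = W^s Y + h W^s G Y], so the cross term is at most the increment of the form. *)
Lemma lyapunov_telescope (p n : nat) (Q : 'M[F]_n) (G : 'M[F]_p) (h : F)
    (Y : 'M[F]_(p, n)) (N : nat) (W := 1%:M + h *: G) :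
  psd Q ->
  2 * h * (\sum_(s < N) qb Q (W ^+ s *m G *m Y) (W ^+ s *m Y)) <=
    qb Q (W ^+ N *m Y) (W ^+ N *m Y) - qb Q Y Y.
Proof.
move=> psdQ; have [QT _] := psdQ.
elim: N => [|N IH]; first by rewrite big_ord0 expr0 mul1mx subrr mulr0.
rewrite big_ord_recr /= mulrDr.
have -> : W ^+ N.+1 *m Y = W ^+ N *m Y + h *: (W ^+ N *m G *m Y).
  rewrite exprSr -[W ^+ N * W]/(W ^+ N *m W) /W mulmxDr mulmx1 mulmxDl.
  by rewrite -scalemxAr -scalemxAl.
rewrite !qbDl !qbDr !qbZl !qbZr (qbC (W ^+ N *m Y) (W ^+ N *m G *m Y) QT).
have := qb_ge0 (W ^+ N *m G *m Y) psdQ.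
have := sqr_ge0 h.
set a := qb _ _ _; set b := qb _ (_ *m Y) (_ *m Y) in IH *; move=> h2 a0.
have : 0 <= h * (h * qb Q (W ^+ N *m G *m Y) (W ^+ N *m G *m Y)).
  by rewrite mulrA -expr2 mulr_ge0 // qb_ge0.
rewrite -/a; lra.
Qed.

End QuadraticForms.

(** * Convergence of powers of stochastic matrices *)

Definition stochastic (F : realFieldType) (p : nat) (W : 'M[F]_p) : Prop :=
  (forall i j, 0 <= W i j) /\ (forall i, \sum_j W i j = 1).

Section StochasticMatrices.
Variables (F : realFieldType) (p : nat).
Implicit Types (W : 'M[F]_p) (z : 'cV[F]_p).

Lemma stochastic_exp W m : stochastic W -> stochastic (W ^+ m).
Proof.
case=> W0 W1; elim: m => [|m [IH0 IH1]].
  rewrite expr0; split=> [i j|i]; first by rewrite mxE ler0n.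
  rewrite (bigD1 i) //= mxE eqxx big1 ?addr0 // => j ji.
  by rewrite mxE eq_sym (negbTE ji).
rewrite exprS -[W * _]/(W *m _); split=> [i j|i].
  by rewrite mxE sumr_ge0 // => l _; rewrite mulr_ge0.
under eq_bigr do rewrite mxE.
rewrite exchange_big /= -[RHS](W1 i); apply: eq_bigr => l _.
by rewrite -mulr_sumr IH1 mulr1.
Qed.

Lemma expS_gt0 W m i j k : stochastic W ->
  0 < W i j -> 0 < (W ^+ m) j k -> 0 < (W ^+ m.+1) i k.
Proof.
move=> stW Wij Wjk; rewrite exprS -[W * _]/(W *m _) mxE (bigD1 j) //=.
rewrite ltr_wpDr ?mulr_gt0 //; apply: sumr_ge0 => l _.
by case: stW (stochastic_exp m stW) => [W0 _] [Wm0 _]; rewrite mulr_ge0.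
Qed.

(** The positive diagonal acts as self-loops at [k], which pad the path to any length [m]. *)
Lemma exp_path_gt0 W k (e : rel 'I_p) : stochastic W -> (forall i, 0 < W i i) ->
  (forall i j, e i j -> 0 < W i j) ->
  forall s i, path e i s -> last i s = k ->
  forall m, (size s <= m)%N -> 0 < (W ^+ m) i k.
Proof.
move=> stW Wd We; elim=> [|j s IH] i /=.
  move=> _ -> m _; elim: m => [|m IHm]; first by rewrite expr0 mxE eqxx ltr01.
  exact: expS_gt0 (Wd k) IHm.
case/andP=> eij pathj lastk [//|m] sm.
by apply: expS_gt0 (We _ _ eij) _ => //; apply: IH.
Qed.

(** A path without repeated vertices has fewer than [p] edges, so the exponent [p] serves all
    rows. *)
Lemma exp_connect_gt0 W k (e : rel 'I_p) : stochastic W -> (forall i, 0 < W i i) ->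
  (forall i j, e i j -> 0 < W i j) -> (forall i, connect e i k) ->
  forall i, 0 < (W ^+ p) i k.
Proof.
move=> stW Wd We conn i; case/connectP: (conn i) => s0 path0 last0.
case/shortenP: path0 last0 => s paths uniqs _ lasts.
apply: (exp_path_gt0 stW Wd We paths (esym lasts)).
have := card_uniqP uniqs => /= card_s.
by have := max_card (mem (i :: s)); rewrite card_s card_ord => /ltnW.
Qed.

(* Each row puts weight at least [b] on the entry [k]; only the remaining [1 - b] spreads. *)
Lemma stochastic_contract W k b z lo hi i : stochastic W -> (forall i, b <= W i k) ->
  (forall l, lo <= z l ord0 <= hi) ->
  b * z k ord0 + (1 - b) * lo <= (W *m z) i ord0 <= b * z k ord0 + (1 - b) * hi.
Proof.
case=> W0 W1 Wk zb; rewrite mxE.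
(* As row [i] sums to [1], the constant [c] can be spread over its entries; both bounds then compare
   with the product entry by entry. *)
have key c : b * z k ord0 + (1 - b) * c =
    W i k * c + \sum_(l | l != k) W i l * c + b * (z k ord0 - c).
  have : \sum_l W i l * c = c by rewrite -mulr_suml W1 mul1r.
  by rewrite (bigD1 k) //= => ->; ring.
have split_k : \sum_l W i l * z l ord0 =
    W i k * z k ord0 + \sum_(l | l != k) W i l * z l ord0 by rewrite (bigD1 k).
have wi := Wk i; have /andP[zlo zhi] := zb k.
rewrite (key lo) (key hi) split_k; apply/andP; split.
  have : \sum_(l | l != k) W i l * lo <= \sum_(l | l != k) W i l * z l ord0.
    by apply: ler_sum => l _; rewrite ler_wpM2l //; case/andP: (zb l).
  have : 0 <= (W i k - b) * (z k ord0 - lo) by rewrite mulr_ge0 ?subr_ge0.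
  lra.
have : \sum_(l | l != k) W i l * z l ord0 <= \sum_(l | l != k) W i l * hi.
  by apply: ler_sum => l _; rewrite ler_wpM2l //; case/andP: (zb l).
have : 0 <= (W i k - b) * (hi - z k ord0) by rewrite mulr_ge0 ?subr_ge0.
lra.
Qed.

Lemma stochastic_contract_exp W k b z N : stochastic W -> (forall i, b <= W i k) ->
  (forall l, 0 <= z l ord0 <= 1) ->
  exists c, forall i, c <= (W ^+ N *m z) i ord0 <= c + (1 - b) ^+ N.
Proof.
move=> stW Wk zb; elim: N => [|N [c IH]].
  by exists 0 => i; rewrite !expr0 mul1mx add0r.
exists (b * (W ^+ N *m z) k ord0 + (1 - b) * c) => i.
rewrite exprS -[W * _]/(W *m _) -mulmxA.
have := stochastic_contract i stW Wk IH.
by rewrite (_ : _ + (1 - b) * (c + _) = b * (W ^+ N *m z) k ord0 + (1 - b) * c +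
   (1 - b) ^+ N.+1) // exprS; ring.
Qed.

(** Column [l] of [W ^+ N] is the image of a basis vector, whose entries lie in [[0, 1]]; each
    factor [W] shrinks the range by [1 - b]. *)
Lemma exp_entry_spread W k b N i j l : stochastic W -> (forall i, b <= W i k) ->
  `|(W ^+ N) i l - (W ^+ N) j l| <= (1 - b) ^+ N.
Proof.
move=> stW Wk.
have [|c hc] := stochastic_contract_exp (z := delta_mx l ord0) N stW Wk.
  by move=> m; rewrite mxE andbT; case: eqP; rewrite ?lexx ler01.
have col m : (W ^+ N *m (delta_mx l ord0 : 'cV_p)) m ord0 = (W ^+ N) m l.
  by rewrite -colE mxE.
have := hc i; have := hc j; rewrite !col ler_norml.
move=> /andP[? ?] /andP[? ?]; apply/andP; split; lra.
Qed.

Lemma exp_left_invariant W (r : 'cV[F]_p) N : r^T *m W = r^T -> r^T *m W ^+ N = r^T.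
Proof.
move=> rW; elim: N => [|N IH]; first by rewrite expr0 mulmx1.
by rewrite exprS -[W * _]/(W *m _) mulmxA rW.
Qed.

(** By invariance [r l] is the [r]-weighted mean of column [l] of [W ^+ N], so the error is a mean
    of differences within that column. Weights of unknown sign give the factor [\sum_j |r j|]. *)
Lemma exp_entry_limit W k b (r : 'cV[F]_p) N i l : stochastic W -> (forall i, b <= W i k) ->
  r^T *m W = r^T -> \sum_i r i ord0 = 1 ->
  `|(W ^+ N) i l - r l ord0| <= (\sum_j `|r j ord0|) * (1 - b) ^+ N.
Proof.
move=> stW Wk rW r1.
have -> : (W ^+ N) i l - r l ord0 = \sum_j r j ord0 * ((W ^+ N) i l - (W ^+ N) j l).
  under eq_bigr do rewrite mulrBr.
  rewrite sumrB -mulr_suml r1 mul1r; congr (_ - _).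
  have /matrixP/(_ ord0 l) := exp_left_invariant N rW.
  by rewrite !mxE => <-; apply: eq_bigr => j _; rewrite mxE.
apply: le_trans (ler_norm_sum _ _ _) _; rewrite mulr_suml; apply: ler_sum => j _.
by rewrite normrM ler_wpM2l // (exp_entry_spread _ _ _ _ stW Wk).
Qed.

(** The step [h] makes [h |G i i| < 1], which keeps the diagonal positive; zero row sums of [G] give
    unit row sums of [W]. *)
Lemma laplacian_stochastic (G : 'M[F]_p) (h := (1 + \sum_i `|G i i|)^-1) (W := 1%:M + h *: G) :
  (forall i j, i != j -> 0 <= G i j) -> (forall i, \sum_j G i j = 0) ->
  [/\ 0 < h, stochastic W, forall i, 0 < W i i & forall i j, 0 < G i j -> 0 < W i j].
Proof.
move=> Goff Grow.
have s0 : 0 < 1 + \sum_i `|G i i| by rewrite ltr_wpDr ?ltr01 ?sumr_ge0.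
have h0 : 0 < h by rewrite invr_gt0.
have Wd i : 0 < W i i.
  rewrite !mxE eqxx -(pmulr_rgt0 _ s0) mulrDr mulr1n mulr1 mulrA mulfV ?gt_eqF // mul1r.
  have : `|G i i| <= \sum_i `|G i i|.
    by rewrite (bigD1 i) //= lerDl sumr_ge0.
  have := ler_norm (- G i i); rewrite normrN; lra.
have WG i j : i != j -> W i j = h * G i j.
  by move=> /negbTE ij; rewrite !mxE ij mulr0n add0r.
split=> //; last first.
  by move=> i j Gij; have [<- //|ij] := eqVneq i j; rewrite WG // mulr_gt0.
split=> [i j|i].
  have [<-|ij] := eqVneq i j; first exact/ltW/Wd.
  by rewrite WG // mulr_ge0 ?Goff // ltW.
under eq_bigr do rewrite mxE [X in _ + X]mxE.
rewrite big_split /= -mulr_sumr Grow mulr0 addr0.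
rewrite (bigD1 i) //= mxE eqxx big1 ?addr0 // => j ji.
by rewrite mxE eq_sym (negbTE ji).
Qed.

End StochasticMatrices.

Lemma laplacian_exp_limit (p : nat) (G : 'M[R]_p) (r : 'cV[R]_p)
    (h := (1 + \sum_i `|G i i|)^-1) (W := 1%:M + h *: G) :
  (forall i j, i != j -> 0 <= G i j) -> (forall i, \sum_j G i j = 0) ->
  (exists k, forall i, connect (fun i j => 0 < G i j) i k) ->
  r^T *m G = 0 -> \sum_i r i ord0 = 1 ->
  0 < h /\ exists N, (0 < N)%N /\ fnorm2 (W ^+ N - const_mx 1 *m r^T) <= 1 / 2.
Proof.
move=> Goff Grow [k conn] rG r1.
have [h0 stW Wd We] := laplacian_stochastic Goff Grow.
rewrite -/h -/W in h0 stW Wd We; split=> //.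
have S0 := exp_connect_gt0 stW Wd We conn.
have stS := stochastic_exp p stW.
set S := W ^+ p in S0 stS.
have p0 : (0 < p)%N by apply: leq_ltn_trans (ltn_ord k).
(* The initial value [1] of the minimum ensures [b <= 1]. *)
pose b := \big[Num.min/1]_i S i k.
have b0 : 0 < b by apply: lt_bigmin => [|i _]; [exact: ltr01 | exact: S0].
have bS i : b <= S i k by apply: bigmin_le.
have b1 : b <= 1 by apply: bigmin_le_id.
have rW : r^T *m W = r^T by rewrite mulmxDr mulmx1 -scalemxAr rG scaler0 addr0.
have rS : r^T *m S = r^T by apply: exp_left_invariant.
(* There are [p * p] entries, each at most [(\sum_j |r j|) * q] with [q] a power of [1 - b]. The
   choice of [eta] below gives [a * eta <= 1 / 2]. *)
pose a := (\sum_j `|r j ord0|) ^+ 2 *+ (p * p).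
have a0 : 0 <= a by rewrite mulrn_wge0 ?sqr_ge0.
pose eta := (1 + 2 * a)^-1.
have eta0 : 0 < eta by rewrite invr_gt0; lra.
have [|N0 hN0] := pow_lt_1_zero (1 - b) _ eta (RltP eta0).
  by rewrite RabsE; apply/RltP; rewrite R1E ger0_norm ?subr_ge0 // ltrBlDr ltrDl.
have {}hN0 : (1 - b) ^+ N0.+1 <= eta.
  have /RltP := hN0 N0.+1 (le_S _ _ (le_n _)); rewrite RabsE RpowE.
  by move/ltW; apply: le_trans (ler_norm _).
exists (p * N0.+1)%N; split; first by rewrite muln_gt0 p0.
rewrite exprM -/S.
have q0 : 0 <= (1 - b) ^+ N0.+1 by rewrite exprn_ge0 // subr_ge0.
move: hN0 q0; set q := (1 - b) ^+ N0.+1 => hN0 q0.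
apply: (@le_trans _ _ (a * q ^+ 2)).
  rewrite /a mulrnAl -exprMn.
  have -> : ((\sum_j `|r j ord0|) * q) ^+ 2 *+ (p * p) =
      \sum_(i < p) \sum_(j < p) ((\sum_j `|r j ord0|) * q) ^+ 2.
    by rewrite !sumr_const !card_ord mulrnA.
  apply: ler_sum => i _; apply: ler_sum => l _.
  have -> : (S ^+ N0.+1 - const_mx 1 *m r^T) i l = (S ^+ N0.+1) i l - r l ord0.
    by rewrite !mxE big_ord1 !mxE mul1r.
  rewrite -[X in X <= _]real_normK ?num_real // ler_sqr ?nnegrE //.
    exact: exp_entry_limit stS bS rS r1.
  by rewrite mulr_ge0 // sumr_ge0.
have q2 : q ^+ 2 <= eta.
  have eta1 : eta <= 1 by rewrite invf_le1; lra.
  by rewrite expr2; apply: le_trans (ler_pM q0 q0 hN0 (le_trans hN0 eta1)) _; rewrite mulr1.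
apply: le_trans (ler_wpM2l a0 q2) _.
by rewrite /eta ler_pdivrMr; lra.
Qed.

(** * Spectral bounds without eigenvalues *)

Section SpectralBounds.
Variables (F : realFieldType) (n : nat).

Lemma qb_mulmxr (p : nat) (M : 'M[F]_n) (A B : 'M[F]_(p, n)) :
  qb 1%:M (A *m M) B = qb M A B.
Proof. by rewrite /qb mulmx1. Qed.

(** Expansion of [|A M - A|^2 >= 0]. *)
Lemma qb_le_avg (p : nat) (M : 'M[F]_n) (A : 'M[F]_(p, n)) :
  2 * qb M A A <= fnorm2 (A *m M) + fnorm2 A.
Proof.
have := fnorm2_ge0 (A *m M + (- 1) *: A); rewrite !fnorm2_qb.
rewrite !qbDl !qbDr !qbZl !qbZr (qbC A (A *m M) (trmx1 _ _)) (qb_mulmxr M A A); lra.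
Qed.

(** In operator terms, [0 <= M <= K] implies [M^2 <= K M]; this follows from nonnegativity of the
    form at [A - K^-1 A M]. *)
Lemma fnorm2_mulmx_le_qb (p : nat) (M : 'M[F]_n) (K : F) (A : 'M[F]_(p, n)) :
  psd M -> 0 < K -> (forall B : 'M[F]_(p, n), qb M B B <= K * fnorm2 B) ->
  fnorm2 (A *m M) <= K * qb M A A.
Proof.
move=> psdM K0 MK; have [MT _] := psdM.
have h := qb_ge0 (A + (- K^-1) *: (A *m M)) psdM.
have hK := MK (A *m M).
have sq : qb M A (A *m M) = fnorm2 (A *m M).
  by rewrite fnorm2_qb qb_mulmxr.
rewrite !qbDl !qbDr !qbZl !qbZr (qbC (A *m M) A MT) sq in h.
have KV : 0 < K^-1 by rewrite invr_gt0.
have : K^-1 * (K^-1 * qb M (A *m M) (A *m M)) <= K^-1 * fnorm2 (A *m M).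
  by rewrite ler_wpM2l ?(ltW KV) // ler_pdivrMl.
move=> h2; rewrite -ler_pdivrMl //; lra.
Qed.

Lemma psd_contraction (p : nat) (M : 'M[F]_n) (A : 'M[F]_(p, n)) :
  psd M -> (forall B : 'M[F]_(p, n), fnorm2 (B *m M) <= fnorm2 B) ->
  qb M A A <= fnorm2 A /\ fnorm2 (A *m M) <= qb M A A.
Proof.
move=> psdM M1.
have h (B : 'M[F]_(p, n)) : qb M B B <= fnorm2 B.
  by have := qb_le_avg M B; have := M1 B; lra.
split=> //; rewrite -[leRHS]mul1r; apply: fnorm2_mulmx_le_qb => // B.
by rewrite mul1r.
Qed.

Lemma fnorm2_rows (p : nat) (A : 'M[F]_(p, n)) : fnorm2 A = \sum_i fnorm2 (row i A).
Proof.
by apply: eq_bigr => i _; rewrite /fnorm2 big_ord1; apply: eq_bigr => j _; rewrite mxE.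
Qed.

Lemma fnorm2Z (p : nat) c (A : 'M[F]_(p, n)) : fnorm2 (c *: A) = c ^+ 2 * fnorm2 A.
Proof. by rewrite !fnorm2_qb qbZl qbZr mulrA expr2. Qed.

Lemma fnorm2_eq0 (p : nat) (A : 'M[F]_(p, n)) : fnorm2 A = 0 -> A = 0.
Proof.
move=> A0; apply/matrixP => i j; apply/eqP; rewrite mxE -sqrf_eq0 eq_le sqr_ge0 andbT.
by rewrite -A0 entry_le_fnorm2.
Qed.

End SpectralBounds.

(* With [l] the largest number such that [M - l] is positive semidefinite, unit vectors [u]
   with [u (M - l) u^T] small are almost eigenvectors for [l], so [|u M|] is close to [l]. *)
Lemma rayleigh_ge_sigma_min (n : nat) (M : 'M[R]_n) (eps : R) :
  psd M -> 0 < eps ->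
  (forall u : 'rV[R]_n, eps ^+ 2 * fnorm2 u <= fnorm2 (u *m M)) ->
  forall u : 'rV[R]_n, eps * fnorm2 u <= qb M u u.
Proof.
move=> psdM eps0 sM u0; rewrite leNgt; apply/negP => u0lt.
have [MT _] := psdM.
pose below t := forall u : 'rV[R]_n, t * fnorm2 u <= qb M u u.
have fu0 : 0 < fnorm2 u0.
  rewrite lt0r fnorm2_ge0 andbT; apply/eqP => f0; move: u0lt.
  by rewrite f0 mulr0 ltNge qb_ge0.
have [||l [lub1 lub2]] := Raxioms.completeness below.
- exists (qb M u0 u0 / fnorm2 u0) => t bt; apply/RleP.
  by rewrite ler_pdivlMr.
- by exists 0 => u; rewrite mul0r qb_ge0.
have l0 : 0 <= l by apply/RleP; apply: lub1 => u; rewrite mul0r qb_ge0.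
have bl : below l.
  move=> u; have [f0|f_neq0] := eqVneq (fnorm2 u) 0; first by rewrite f0 mulr0 qb_ge0.
  have f0 : 0 < fnorm2 u by rewrite lt0r f_neq0 fnorm2_ge0.
  rewrite -ler_pdivlMr //; apply/RleP/lub2 => t bt; apply/RleP.
  by rewrite ler_pdivlMr.
have leps : l < eps.
  by rewrite -(ltr_pM2r fu0); apply: le_lt_trans u0lt; apply: bl.
pose A := M + (- l)%:M.
have qbA (B C : 'rV[R]_n) : qb A B C = qb M B C - l * qb 1%:M B C.
  rewrite /A /qb mulmxDr mulmxDl linearD /=; congr (_ + _).
  by rewrite mul_mx_scalar -scalemxAl linearZ /= mulmx1 mulNr.
have psdA : psd A.
  split=> [|v]; first by rewrite /A linearD /= MT tr_scalar_mx.
  have := bl v^T; rewrite fnorm2_qb => h.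
  have : 0 <= qb A v^T v^T by rewrite qbA subr_ge0.
  by rewrite /qb trmxK /mxtrace big_ord1.
(* Any positive upper bound for the form of [A] will do. *)
pose K := 1 + fnorm2 A.
have K0 : 0 < K by rewrite /K; have := fnorm2_ge0 A; lra.
have AK (B : 'rV[R]_n) : qb A B B <= K * fnorm2 B.
  have := qb_le_avg A B.
  have : fnorm2 (B *m A) <= fnorm2 A * fnorm2 B.
    rewrite -[fnorm2 (B *m A)]fnorm2_tr trmx_mul -(fnorm2_tr B) -(fnorm2_tr A).
    exact: fnorm2_mulmx_le.
  have := mulr_ge0 (fnorm2_ge0 A) (fnorm2_ge0 B); have := fnorm2_ge0 B.
  rewrite /K mulrDl mul1r; lra.
pose c := eps ^+ 2 - l ^+ 2.
have c0 : 0 < c by rewrite subr_gt0 ltr_pXn2r // nnegrE ltW.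
pose d := K + 2 * l.
have d0 : 0 < d by rewrite /d; lra.
(* For [u] with [qb A u u < eta |u|^2], expanding [|u M|^2 >= eps^2 |u|^2] yields
   [c |u|^2 <= d * qb A u u]. This [eta] makes the right side at most [c |u|^2 / 2], a
   contradiction. *)
pose eta := c / (2 * d).
have eta0 : 0 < eta by rewrite divr_gt0 // mulr_gt0 // ltr0n.
have [u hu] : exists u : 'rV[R]_n, qb M u u < (l + eta) * fnorm2 u.
  apply: Classical_Prop.NNPP => no; have : l + eta <= l.
    apply/RleP/lub1 => u; rewrite leNgt; apply/negP => hu.
    by apply: no; exists u.
  by rewrite gerDl leNgt eta0.
have := fnorm2_mulmx_le_qb u psdA K0 AK.
have := sM u.
have -> : fnorm2 (u *m M) = fnorm2 (u *m A) + 2 * l * qb A u u + l ^+ 2 * fnorm2 u.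
  have -> : u *m M = u *m A + l *: u.
    by rewrite /A mulmxDr mul_mx_scalar scaleNr subrK.
  rewrite !fnorm2_qb !qbDl !qbDr !qbZl !qbZr (qbC u (u *m A) (trmx1 _ _)) (qb_mulmxr A u u).
  by ring.
have : qb A u u < eta * fnorm2 u by rewrite qbA -fnorm2_qb; lra.
set f := fnorm2 u in hu *; set q := qb A u u => qlt h1 h2.
have q0 : 0 <= q by apply: qb_ge0.
have : c * f <= d * q by rewrite /c /d; lra.
have : d * q <= d * (eta * f) by rewrite ler_pM2l // ltW.
have -> : d * (eta * f) = c * f / 2 by rewrite /eta; field; rewrite gt_eqF.
have f0 : 0 < f by rewrite -(pmulr_rgt0 _ eta0); apply: le_lt_trans qlt.
have := mulr_gt0 c0 f0; lra.
Qed.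

(** * Operator norm and smallest singular value *)

Lemma vnormE (n : nat) (v : 'cV[R]_n) : vnorm v = Num.sqrt (fnorm2 v).
Proof.
rewrite /vnorm (_ : \sum_(k < n) _ = fnorm2 v) ?RsqrtE ?fnorm2_ge0 //.
by apply: eq_bigr => k _; rewrite big_ord1 expr2.
Qed.

Lemma vnorm_eq1 (n : nat) (v : 'cV[R]_n) : fnorm2 v = 1 -> vnorm v = 1.
Proof. by move=> v1; rewrite vnormE v1 sqrtr1. Qed.

(** Carries bounds over unit vectors, as in [opnorm] and [sigma_min], to all vectors by
    homogeneity. *)
Lemma unit_vector (n : nat) (v : 'cV[R]_n) : v != 0 ->
  exists w, fnorm2 w = 1 /\ v = Num.sqrt (fnorm2 v) *: w.
Proof.
move=> v0.
have f0 : 0 < fnorm2 v.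
  by rewrite lt0r fnorm2_ge0 andbT; apply: contraNN v0 => /eqP/fnorm2_eq0 ->.
have s0 : Num.sqrt (fnorm2 v) != 0 by rewrite gt_eqF // sqrtr_gt0.
exists ((Num.sqrt (fnorm2 v))^-1 *: v); split.
  by rewrite fnorm2Z exprVn sqr_sqrtr ?(ltW f0) // mulVf // gt_eqF.
by rewrite scalerA mulfV // scale1r.
Qed.

Lemma opnorm_le1 (n : nat) (A : 'M[R]_n) (v : 'cV[R]_n) :
  Rbar_le (opnorm A) (Rbar.Finite R1) -> fnorm2 (A *m v) <= fnorm2 v.
Proof.
move=> A1; have [->|v0] := eqVneq v 0; first by rewrite mulmx0.
have [w [w1 ->]] := unit_vector v0.
rewrite -scalemxAr !fnorm2Z w1 ler_wpM2l ?sqr_ge0 //.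
have [ub _] := Lub_Rbar_correct (fun y => exists x : 'cV[R]_n, vnorm x = 1 /\ y = vnorm (A *m x)).
have := Rbar_le_trans _ _ _ (ub _ (ex_intro _ w (conj (vnorm_eq1 w1) erefl))) A1.
rewrite vnormE /= => h; have {}h : Num.sqrt (fnorm2 (A *m w)) <= 1 by apply/RleP.
by rewrite -ler_sqrt ?ltr01 // sqrtr1.
Qed.

Lemma sigma_min_ge (n : nat) (A : 'M[R]_n) (eps : R) (v : 'cV[R]_n) :
  0 < eps -> Rbar_le (Rbar.Finite eps) (sigma_min A) ->
  eps ^+ 2 * fnorm2 v <= fnorm2 (A *m v).
Proof.
move=> eps0 Aeps; have [->|v0] := eqVneq v 0.
  by rewrite mulmx0 [fnorm2 _]fnorm2_qb /qb !mul0mx linear0 mulr0.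
have [w [w1 ->]] := unit_vector v0.
rewrite -scalemxAr !fnorm2Z w1 mulr1 mulrC ler_wpM2l ?sqr_ge0 //.
have [lb _] := Glb_Rbar_correct (fun y => exists x : 'cV[R]_n, vnorm x = 1 /\ y = vnorm (A *m x)).
have := Rbar_le_trans _ _ _ Aeps (lb _ (ex_intro _ w (conj (vnorm_eq1 w1) erefl))).
rewrite vnormE /= => /RleP h.
rewrite -[leRHS]sqr_sqrtr ?fnorm2_ge0 // ler_pXn2r ?nnegrE ?sqrtr_ge0 //.
exact: ltW.
Qed.

Lemma symPSD_psd (n : nat) (A : 'M[R]_n) : symPSD A -> psd A.
Proof. by case=> AT A0; split=> // v; apply/RleP/A0. Qed.

Lemma symPSD_le1_contraction (n p : nat) (Q : 'M[R]_n) (A : 'M[R]_(p, n)) :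
  symPSD_le1 Q -> qb Q A A <= fnorm2 A /\ fnorm2 (A *m Q) <= qb Q A A.
Proof.
case=> psdQ Q1; apply: psd_contraction (symPSD_psd psdQ) _ => B.
rewrite (fnorm2_rows B) (fnorm2_rows (B *m Q)); apply: ler_sum => i _.
by rewrite row_mul -fnorm2_tr -[leRHS]fnorm2_tr trmx_mul (proj1 psdQ) opnorm_le1.
Qed.

(** * Dissipation along the flow *)

Lemma is_RInt_bigsum (I : Type) (s : seq I) (u : I -> R -> R) (a b : R) (l : I -> R) :
  (forall i, is_RInt (u i) a b (l i)) ->
  is_RInt (fun t => \sum_(i <- s) u i t) a b (\sum_(i <- s) l i).
Proof.
move=> ul; elim: s => [|i s IH].
  rewrite big_nil; apply: (is_RInt_ext (fun _ => zero)) => [t _|].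
    by rewrite big_nil.
  have := is_RInt_const a b (zero : R_NormedModule).
  by rewrite scal_zero_r.
rewrite big_cons; apply: is_RInt_ext (is_RInt_plus _ _ _ _ _ _ (ul i) IH) => t _.
by rewrite big_cons.
Qed.

Lemma ex_RInt_bigsum (I : Type) (s : seq I) (u : I -> R -> R) (a b : R) :
  (forall i, ex_RInt (u i) a b) -> ex_RInt (fun t => \sum_(i <- s) u i t) a b.
Proof.
move=> intu; exists (\sum_(i <- s) RInt (u i) a b).
by apply: is_RInt_bigsum => i; apply: RInt_correct.
Qed.

Lemma primitive_ext (u u' f f' : R -> R) (a b : R) :
  (forall t, u t = u' t) -> (forall t, f t = f' t) ->
  primitive_on u f a b -> primitive_on u' f' a b.
Proof.
move=> uu ff prim s t hs st tb; rewrite -!ff.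
by apply: is_RInt_ext (prim s t hs st tb) => r _.
Qed.

Lemma primitive_bigsum (I : Type) (r : seq I) (u f : I -> R -> R) (a b : R) :
  (forall i, primitive_on (u i) (f i) a b) ->
  primitive_on (fun t => \sum_(i <- r) u i t) (fun t => \sum_(i <- r) f i t) a b.
Proof.
move=> prim s t hs st tb.
have -> : Rminus (\sum_(i <- r) f i t) (\sum_(i <- r) f i s) =
    \sum_(i <- r) (Rminus (f i t) (f i s)) by symmetry; apply: sumrB.
by apply: is_RInt_bigsum => i; apply: prim.
Qed.

Lemma primitive_scale (c : R) (u f : R -> R) (a b : R) :
  primitive_on u f a b -> primitive_on (fun t => c * u t) (fun t => c * f t) a b.
Proof.
move=> prim s t hs st tb.
rewrite -Rmult_minus_distr_l; exact: (is_RInt_scal _ _ _ c _ (prim s t hs st tb)).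
Qed.

Lemma primitive_ex_lipschitz (u f : R -> R) (a b : R) : a <= b ->
  primitive_on u f a b -> exists L, Rle 0 L /\ lipschitz_on f a b L.
Proof.
move=> /RleP ab prim.
have [|M [M0 uM]] := @ex_RInt_bounded u a b ab.
  by exists (Rminus (f b) (f a)); apply: prim => //; apply: Rle_refl.
exists M; split; first exact: Rlt_le.
exact: primitive_lipschitz prim uM.
Qed.

Lemma qb_sum_mulmx (F : realFieldType) (p n : nat) (Q : 'M[F]_n) (A B : 'M[F]_(p, n)) :
  qb Q A B = \sum_i \sum_a (A *m Q) i a * B i a.
Proof.
apply: eq_bigr => i _; rewrite mxE; apply: eq_bigr => a _.
by rewrite [B^T _ _]mxE.
Qed.

Section ConsensusFlow.
Variables (n p : nat) (Q : R -> 'M[R]_n) (G : 'M[R]_p) (r : 'cV[R]_p).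
Variables (h : R) (N : nat) (Y : R -> 'M[R]_(p, n)).
Let W := 1%:M + h *: G.

Hypothesis W_mixing : fnorm2 (W ^+ N - const_mx 1 *m r^T) <= 1 / 2.
Hypothesis Q_le1 : forall t, 0 <= t -> symPSD_le1 (Q t).
Hypothesis Q_int : riemann_integrable_on_nonneg Q.
Hypothesis Y_mean0 : forall t, 0 <= t -> r^T *m Y t = 0.
Hypothesis Y_flow : forall b i a,
  primitive_on (fun t => (G *m Y t *m Q t) i a) (fun t => Y t i a) 0 b.

(** The quadratic form of [P = \sum_(s < N) (W^s)^T W^s], a truncated solution of the discrete
    Lyapunov equation [P - W^T P W = 1]. *)
Definition lyapunov (t : R) : R := \sum_(s < N) fnorm2 (W ^+ s *m Y t).

Definition dissipation (s t : R) : R := RInt (fun q => qb (Q q) (Y q) (Y q)) s t.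

Lemma flow_mulmx (E : 'M[R]_p) b i a :
  primitive_on (fun t => (E *m G *m Y t *m Q t) i a) (fun t => (E *m Y t) i a) 0 b.
Proof.
apply: (@primitive_ext (fun t => \sum_j E i j * (G *m Y t *m Q t) j a) _
                       (fun t => \sum_j E i j * Y t j a)) => [t|t|].
- by rewrite -!mulmxA [RHS]mxE.
- by rewrite mxE.
- by apply: primitive_bigsum => j; apply: primitive_scale.
Qed.

Lemma lyapunov_flow b : 0 <= b ->
  primitive_on (fun t => \sum_(s < N) 2 * qb (Q t) (W ^+ s *m G *m Y t) (W ^+ s *m Y t))
    lyapunov 0 b.
Proof.
move=> /RleP b0; apply: primitive_bigsum => s.
set E := W ^+ s.
apply: (@primitive_ext
  (fun t => \sum_i \sum_a ((E *m G *m Y t *m Q t) i a * (E *m Y t) i a +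
                           (E *m Y t) i a * (E *m G *m Y t *m Q t) i a)) _
  (fun t => \sum_i \sum_a (E *m Y t) i a * (E *m Y t) i a)) => [t|t|].
- rewrite qb_sum_mulmx mulr_sumr; apply: eq_bigr => i _; rewrite mulr_sumr.
  by apply: eq_bigr => a _; ring.
- by apply: eq_bigr => i _; apply: eq_bigr => a _; rewrite expr2.
- apply: primitive_bigsum => i; apply: primitive_bigsum => a.
  exact: primitive_mult b0 (@flow_mulmx E b i a) (@flow_mulmx E b i a).
Qed.

(** Each term is an entry of [Q] times a product of two entries of [Y]; that product is a primitive,
    hence Lipschitz. *)
Lemma dissipation_rate_integrable s t : 0 <= s -> s <= t ->
  ex_RInt (fun q => qb (Q q) (Y q) (Y q)) s t.
Proof.
move=> s0 st; have t0 : 0 <= t := le_trans s0 st.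
apply: (ex_RInt_ext (fun q => \sum_i \sum_b \sum_a Q q a b * (Y q i a * Y q i b))).
  move=> q _; rewrite qbE; do 3! (apply: eq_bigr => ? _); ring.
apply: ex_RInt_bigsum => i; apply: ex_RInt_bigsum => b; apply: ex_RInt_bigsum => a.
apply: (@ex_RInt_sub _ 0 t); try exact/RleP.
have prim := primitive_mult (RleP t0) (@Y_flow t i a) (@Y_flow t i b).
have [L [L0 lipL]] := primitive_ex_lipschitz t0 prim.
by apply: ex_RInt_mult_lipschitz lipL => //; [apply/RleP | apply: Q_int => //; [exact: Rle_refl | apply/RleP]].
Qed.

Lemma Q_psd t : 0 <= t -> psd (Q t).
Proof. by move=> /Q_le1[/symPSD_psd]. Qed.

Lemma dissipation_is_RInt s t : 0 <= s -> s <= t ->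
  is_RInt (fun q => qb (Q q) (Y q) (Y q)) s t (dissipation s t).
Proof. by move=> s0 st; apply/RInt_correct/dissipation_rate_integrable. Qed.

Lemma le_is_RInt (f g : R -> R) (s t If Ig : R) : s <= t ->
  is_RInt f s t If -> is_RInt g s t Ig ->
  (forall q, s <= q <= t -> f q <= g q) -> If <= Ig.
Proof.
move=> /RleP st If_ Ig_ fg; apply/RleP; apply: is_RInt_le st If_ Ig_ _ => q [sq qt].
by apply/RleP/fg; rewrite !(introT RleP) //; apply: Rlt_le.
Qed.

Lemma dissipation_ge0 s t : 0 <= s -> s <= t -> 0 <= dissipation s t.
Proof.
move=> s0 st; rewrite -[X in X <= _](mulr0 (t - s)).
apply: le_is_RInt st (is_RInt_const _ _ _) (dissipation_is_RInt s0 st) _ => q /andP[sq _].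
exact/qb_ge0/Q_psd/(le_trans s0).
Qed.

Lemma dissipation_le s q t : 0 <= s -> s <= q -> q <= t ->
  dissipation s q <= dissipation s t.
Proof.
move=> s0 sq qt.
have q0 := le_trans s0 sq.
have := is_RInt_Chasles _ _ _ _ _ _ (dissipation_is_RInt s0 sq) (dissipation_is_RInt q0 qt).
move/is_RInt_unique; rewrite -/(dissipation s t) => ->.
by rewrite /Hierarchy.plus /= lerDl dissipation_ge0.
Qed.

(** Since [r^T Y = 0], the limit [1 r^T] can be subtracted from [W ^+ N] for free. *)
Lemma mixed_form_le t : 0 <= t ->
  qb (Q t) (W ^+ N *m Y t) (W ^+ N *m Y t) <= 1 / 2 * qb (Q t) (Y t) (Y t).
Proof.
move=> t0; have psdQ := Q_psd t0.
have -> : W ^+ N *m Y t = (W ^+ N - const_mx 1 *m r^T) *m Y t.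
  by rewrite mulmxBl -mulmxA Y_mean0 // mulmx0 subr0.
by apply: le_trans (qb_mulmx_le _ _ psdQ) _; rewrite ler_wpM2r ?qb_ge0.
Qed.

(** Pointwise, [2 h V'] is twice the telescoped sum, hence at most [2 (1/2 - 1)] times the form of
    [Q_t] at [Y]. *)
Lemma lyapunov_decrease s t : 0 <= s -> s <= t ->
  2 * h * (lyapunov t - lyapunov s) <= - dissipation s t.
Proof.
move=> s0 st; have t0 := le_trans s0 st.
have primV : is_RInt
    (fun q => \sum_(k < N) 2 * qb (Q q) (W ^+ k *m G *m Y q) (W ^+ k *m Y q)) s t
    (Rminus (lyapunov t) (lyapunov s)).
  by apply: (lyapunov_flow t0); try exact/RleP.
have I1 := is_RInt_scal _ _ _ (2 * h) _ primV.
have I2 := is_RInt_scal _ _ _ (- 1) _ (dissipation_is_RInt s0 st).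
rewrite -[leRHS]mulN1r; apply: le_is_RInt st I1 I2 _ => q /andP[sq _].
have q0 := le_trans s0 sq.
have := lyapunov_telescope G h (Y q) N (Q_psd q0).
have := mixed_form_le q0.
rewrite /scal /= /mult /= -/W -mulr_sumr => h1 h2.
change (2 * h * (2 * \sum_(i < N) qb (Q q) (W ^+ i *m G *m Y q) (W ^+ i *m Y q)) <=
  - 1 * qb (Q q) (Y q) (Y q)).
lra.
Qed.

(** The bound [|Q_t| <= 1] enters as [Q_t^2 <= Q_t], which controls the speed by the dissipation
    rate. *)
Lemma flow_speed_le t i a : 0 <= t ->
  ((G *m Y t *m Q t) i a) ^+ 2 <= fnorm2 G * qb (Q t) (Y t) (Y t).
Proof.
move=> t0; rewrite -mulmxA; apply: le_trans (entry_le_fnorm2 _ _ _) _.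
apply: le_trans (fnorm2_mulmx_le _ _) _; rewrite ler_wpM2l ?fnorm2_ge0 //.
by case: (symPSD_le1_contraction (Y t) (Q_le1 t0)).
Qed.

(* Cauchy-Schwarz for the integral, through [2 c u - c^2 <= u^2] with [c] the mean value,
   so that the square of the speed need not be integrated. *)
Lemma flow_increment_le s t i a : 0 <= s -> s <= t ->
  (Y t i a - Y s i a) ^+ 2 <= (t - s) * (fnorm2 G * dissipation s t).
Proof.
move=> s0; rewrite le_eqVlt => /orP[/eqP <-|st].
  by rewrite !subrr expr0n mul0r.
have d0 : 0 < t - s by rewrite subr_gt0.
have st' := ltW st.
have primY : is_RInt (fun q => (G *m Y q *m Q q) i a) s t (Rminus (Y t i a) (Y s i a)).
  by apply: (@Y_flow t); try exact/RleP.
set D := Y t i a - Y s i a; pose c := D / (t - s).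
have I1 := is_RInt_minus _ _ _ _ _ _ (is_RInt_scal _ _ _ (2 * c) _ primY)
  (is_RInt_const s t (c ^+ 2 : R_NormedModule)).
have I2 := is_RInt_scal _ _ _ (fnorm2 G) _ (dissipation_is_RInt s0 st').
have : 2 * c * D - (t - s) * c ^+ 2 <= fnorm2 G * dissipation s t.
  apply: le_is_RInt st' I1 I2 _ => q /andP[sq _].
  have := flow_speed_le i a (le_trans s0 sq).
  rewrite /minus /Hierarchy.plus /Hierarchy.opp /scal /= /mult /=.
  set u := (G *m Y q *m Q q) i a => hu.
  change (2 * c * u - c ^+ 2 <= fnorm2 G * qb (Q q) (Y q) (Y q)).
  have := sqr_ge0 (u - c); rewrite !expr2 in hu *; lra.
have -> : 2 * c * D - (t - s) * c ^+ 2 = D ^+ 2 / (t - s).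
  by rewrite /c; field; rewrite gt_eqF.
by rewrite ler_pdivrMr // mulrC.
Qed.

Let C := fnorm2 G *+ (p * n).

Lemma flow_drift_le s q t : 0 <= s -> s <= q -> q <= t ->
  fnorm2 (Y s - Y q) <= C * (t - s) * dissipation s t.
Proof.
move=> s0 sq qt; have st := le_trans sq qt.
have -> : C * (t - s) * dissipation s t =
    \sum_(i < p) \sum_(a < n) (t - s) * (fnorm2 G * dissipation s t).
  by rewrite !sumr_const !card_ord -mulrnA /C -!mulrA [(n * p)%N]mulnC !mulrnAl mulrCA.
apply: ler_sum => i _; apply: ler_sum => a _.
rewrite [X in X ^+ 2](_ : _ = - (Y q i a - Y s i a)) ?sqrrN; last by rewrite !mxE opprB.
apply: le_trans (flow_increment_le i a s0 sq) _.
apply: ler_pM; rewrite ?subr_ge0 ?mulr_ge0 ?fnorm2_ge0 ?dissipation_ge0 //.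
  by rewrite lerB.
by rewrite ler_wpM2l ?fnorm2_ge0 // dissipation_le.
Qed.

End ConsensusFlow.

(** * The integral of [Q] over a window *)

Section Gramian.
Variables (n : nat) (Q : R -> 'M[R]_n).
Hypothesis Q_le1 : forall t, 0 <= t -> symPSD_le1 (Q t).
Hypothesis Q_int : riemann_integrable_on_nonneg Q.

Lemma gramian_qb (p : nat) (A : 'M[R]_(p, n)) s t : 0 <= s -> s <= t ->
  is_RInt (fun q => qb (Q q) A A) s t (qb (mxRInt Q s t) A A).
Proof.
move=> s0 st.
rewrite qbE; apply: (is_RInt_ext (fun q => \sum_i \sum_b \sum_a A i a * A i b * Q q a b)).
  move=> q _; rewrite qbE; do 3! (apply: eq_bigr => ? _); ring.
do 3! (apply: is_RInt_bigsum => ?); rewrite mxE mulrAC.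
by apply/(is_RInt_scal (V := R_NormedModule))/RInt_correct/Q_int; apply/RleP.
Qed.

Lemma gramian_psd s t : 0 <= s -> s <= t -> psd (mxRInt Q s t).
Proof.
move=> s0 st; split=> [|v].
  apply/matrixP => a b; rewrite !mxE; apply: RInt_ext => q.
  rewrite Rmin_left ?Rmax_right; try exact/RleP; case=> /RltP sq _.
  by have [QT _] := Q_psd Q_le1 (ltW (le_lt_trans s0 sq)); rewrite -[in LHS]QT mxE.
have -> : (v^T *m mxRInt Q s t *m v) ord0 ord0 = qb (mxRInt Q s t) v^T v^T.
  by rewrite /qb trmxK /mxtrace big_ord1.
rewrite -[X in X <= _](mulr0 (t - s)).
apply: le_is_RInt st (is_RInt_const _ _ _) (gramian_qb s0 st) _ => q /andP[sq _].
exact/qb_ge0/(Q_psd Q_le1)/(le_trans s0).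
Qed.

(** Together with the lower bound by [eps], this forces [eps <= T] on a window of length [T] once
    some [A] is nonzero. *)
Lemma gramian_le (p : nat) (A : 'M[R]_(p, n)) s t : 0 <= s -> s <= t ->
  qb (mxRInt Q s t) A A <= (t - s) * fnorm2 A.
Proof.
move=> s0 st.
apply: le_is_RInt st (gramian_qb s0 st) (is_RInt_const _ _ _) _ => q /andP[sq _].
by case: (symPSD_le1_contraction A (Q_le1 (le_trans s0 sq))).
Qed.

Lemma gramian_ge (p : nat) (A : 'M[R]_(p, n)) s t eps : 0 <= s -> s <= t -> 0 < eps ->
  Rbar_le (Rbar.Finite eps) (sigma_min (mxRInt Q s t)) ->
  eps * fnorm2 A <= qb (mxRInt Q s t) A A.
Proof.
move=> s0 st eps0 sM; have psdM := gramian_psd s0 st.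
rewrite fnorm2_rows qb_row mulr_sumr; apply: ler_sum => i _.
apply: rayleigh_ge_sigma_min => // u.
rewrite -(fnorm2_tr u) -(fnorm2_tr (u *m _)) trmx_mul (proj1 psdM).
exact: sigma_min_ge.
Qed.

End Gramian.

(** * Decrease of the Lyapunov function over exciting windows *)

Section ExcitedFlow.
Variables (n p : nat) (Q : R -> 'M[R]_n) (G : 'M[R]_p) (r : 'cV[R]_p).
Variables (h : R) (N : nat) (Y : R -> 'M[R]_(p, n)).
Let W := 1%:M + h *: G.

Hypothesis h_gt0 : 0 < h.
Hypothesis N_gt0 : (0 < N)%N.
Hypothesis W_mixing : fnorm2 (W ^+ N - const_mx 1 *m r^T) <= 1 / 2.
Hypothesis Q_le1 : forall t, 0 <= t -> symPSD_le1 (Q t).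
Hypothesis Q_int : riemann_integrable_on_nonneg Q.
Hypothesis Y_mean0 : forall t, 0 <= t -> r^T *m Y t = 0.
Hypothesis Y_flow : forall b i a,
  primitive_on (fun t => (G *m Y t *m Q t) i a) (fun t => Y t i a) 0 b.

Let C := fnorm2 G *+ (p * n).
Let V := lyapunov G h N Y.
Let psi := dissipation Q Y.

Lemma excited_dissipation s T eps : 0 <= s -> 0 < T -> 0 < eps ->
  Rbar_le (Rbar.Finite eps) (sigma_min (mxRInt Q s (s + T))) ->
  eps * fnorm2 (Y s) <= (2 + 2 * C * T ^+ 2) * psi s (s + T).
Proof.
move=> s0 T0 eps0 sM.
have st : s <= s + T by rewrite lerDl ltW.
apply: le_trans (gramian_ge Q_le1 Q_int (Y s) s0 st eps0 sM) _.
(* Replacing [Y s] by [Y q] inside the form costs a factor [2] and the drift term [2 C T psi]; the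
   latter is constant in [q], so integration multiplies it by [T]. *)
have I2 := is_RInt_plus _ _ _ _ _ _
  (is_RInt_scal _ _ _ 2 _ (dissipation_is_RInt Q_int Y_flow s0 st))
  (is_RInt_const s (s + T) (2 * (C * T * psi s (s + T)) : R_NormedModule)).
have -> : (2 + 2 * C * T ^+ 2) * psi s (s + T) =
    2 * psi s (s + T) + (s + T - s) * (2 * (C * T * psi s (s + T))) by ring.
apply: le_is_RInt st (gramian_qb Q_int s0 st) I2 _ => q /andP[sq qt].
have q0 := le_trans s0 sq.
apply: le_trans (qb_le_double (Y s) (Y q) (Q_psd Q_le1 q0)) _.
rewrite /Hierarchy.plus /scal /= /mult /=.
apply: lerD => //; rewrite ler_pM2l ?ltr0n //.
apply: le_trans (proj1 (symPSD_le1_contraction _ (Q_le1 q0))) _.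
have := flow_drift_le Q_le1 Q_int Y_flow s0 sq qt.
by rewrite -/C -/psi (_ : s + T - s = T) //; ring.
Qed.

Let K := 1 + \sum_(k < N) fnorm2 (W ^+ k).
(** [K] compares [V] with [|Y|^2], [1 + C] comes from the bounds on [delta], and [2 * h] from the
    decrease of [V]. *)
Let B := K * (1 + C) * (2 * h).

Let K_gt0 : 0 < K.
Proof. by rewrite ltr_wpDr ?ltr01 //; apply: sumr_ge0 => k _; apply: fnorm2_ge0. Qed.

Let C_ge0 : 0 <= C.
Proof. by rewrite mulrn_wge0 // fnorm2_ge0. Qed.

Let B_ge0 : 0 <= B.
Proof.
apply: mulr_ge0; apply: mulr_ge0; [exact: ltW | exact: addr_ge0 | exact: ler0n | exact: ltW].
Qed.

Lemma lyapunov_le t : V t <= K * fnorm2 (Y t).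
Proof.
rewrite /K mulrDl mul1r mulr_suml.
apply: le_trans (_ : \sum_(k < N) fnorm2 (W ^+ k) * fnorm2 (Y t) <= _).
  by apply: ler_sum => k _; apply: fnorm2_mulmx_le.
by rewrite lerDr fnorm2_ge0.
Qed.

(** The term [s = 0] of the sum is [|Y|^2] itself. *)
Lemma lyapunov_ge t : fnorm2 (Y t) <= V t.
Proof.
rewrite /V /lyapunov; case: N N_gt0 => // N' _.
rewrite big_ord_recl expr0 mul1mx lerDl.
by apply: sumr_ge0 => k _; apply: fnorm2_ge0.
Qed.

Lemma lyapunov_step s T eps : 0 <= s -> 0 < T -> 0 < eps ->
  Rbar_le (Rbar.Finite eps) (sigma_min (mxRInt Q s (s + T))) ->
  delta eps T * V s <= B * (V s - V (s + T)).
Proof.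
move=> s0 T0 eps0 sM.
have st : s <= s + T by rewrite lerDl ltW.
have [/RleP d0 dT] := delta_bounds (RltP eps0) (RltP T0).
set d := delta eps T in d0 dT *; set f := fnorm2 (Y s).
have f0 : 0 <= f by apply: fnorm2_ge0.
have exc := excited_dissipation s0 T0 eps0 sM.
have TC : 0 < 2 + 2 * C * T ^+ 2.
  by have := mulr_ge0 C_ge0 (sqr_ge0 T); lra.
have C1 : 0 <= 1 + C by apply: addr_ge0.
have psi0 : 0 <= psi s (s + T) by apply: dissipation_ge0.
have df : d * f <= (1 + C) * psi s (s + T).
  (* A nonzero deviation is required to compare the two Gramian bounds and deduce [eps <= T]. *)
  have [fE|fN] := eqVneq f 0; first by rewrite fE mulr0 mulr_ge0.
  have fP : 0 < f by rewrite lt0r fN.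
  have epsT : eps <= T.
    rewrite -(ler_pM2r fP); have := gramian_ge Q_le1 Q_int (Y s) s0 st eps0 sM.
    have := gramian_le Q_le1 Q_int (Y s) s0 st.
    by rewrite (_ : s + T - s = T); [move=> h1 h2; apply: le_trans h2 h1 | ring].
  have [/RleP d1 /RleP d2] := dT (RleP epsT).
  have {}d1 : 2 * d <= eps.
    by move: d1; rewrite RdivE -[IZR 2]/(2%:R : R) ler_pdivlMr ?ltr0n // mulrC.
  have {}d2 : 2 * (d * T ^+ 2) <= eps.
    by move: d2; rewrite RdivE -[IZR 2]/(2%:R : R) RpowE ler_pdivlMr ?ltr0n // mulrC.
  (* After this scaling, [(2 + 2 C T^2) d f <= (1 + C) eps f], and the dissipation estimate bounds
     [eps f]. *)
  rewrite -(ler_pM2l TC).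
  apply: le_trans (_ : (1 + C) * (eps * f) <= _); last first.
    by rewrite [leRHS]mulrCA ler_wpM2l.
  rewrite !mulrA ler_wpM2r //.
  have : 0 <= C * (eps - 2 * (d * T ^+ 2)) by rewrite mulr_ge0 // subr_ge0.
  lra.
have decr := lyapunov_decrease W_mixing Q_le1 Q_int Y_mean0 Y_flow s0 st.
apply: le_trans (ler_wpM2l d0 (lyapunov_le s)) _.
rewrite mulrCA /B -!mulrA ler_pM2l //.
apply: le_trans df _; rewrite ler_wpM2l //.
have -> : 2 * (h * (V s - V (s + T))) = - (2 * h * (V (s + T) - V s)) by ring.
by rewrite lerNr.
Qed.

(** Divergence of the series makes [V] small at the start of some window; [V] is nonincreasing, so
    it stays small. *)
Lemma flow_vanishes eta : sufficiently_exciting Q -> 0 < eta ->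
  exists M, forall t, M <= t -> fnorm2 (Y t) < eta.
Proof.
case=> eps [T [epsT0 [sM div]]] eta0.
have eps0 k : 0 < eps k by apply/RltP; case: (epsT0 k).
have T0 k : 0 < T k by apply/RltP; case: (epsT0 k).
have t0 k : 0 <= tseq T k by apply: sumr_ge0 => j _; apply: ltW.
have tS k : tseq T k.+1 = tseq T k + T k by rewrite /tseq big_ord_recr.
have [|||||k Vk] := @exists_small_of_divergent_decrease (fun k => V (tseq T k))
    (fun k => delta (eps k) (T k)) B _ _ _ _ div eta.
- exact/RleP.
- by move=> k; apply/RleP/(le_trans _ (lyapunov_ge _))/fnorm2_ge0.
- by move=> k; case: (delta_bounds (proj1 (epsT0 k)) (proj2 (epsT0 k))).
- by move=> k; apply/RleP; rewrite tS; apply: lyapunov_step.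
- exact/RltP.
exists (tseq T k) => t kt; apply: le_lt_trans (lyapunov_ge t) _.
have {}Vk : V (tseq T k) < eta by apply/RltP.
apply: le_lt_trans Vk.
have := lyapunov_decrease W_mixing Q_le1 Q_int Y_mean0 Y_flow (t0 k) kt.
have := dissipation_ge0 Q_le1 Q_int Y_flow (t0 k) kt.
rewrite -/V => h1 h2.
rewrite -subr_le0 -(pmulr_rle0 _ (mulr_gt0 (ltr0n R 2) h_gt0)).
by apply: le_trans h2 _; rewrite oppr_le0.
Qed.

End ExcitedFlow.

(** * Reduction to the deviations *)

Lemma laplacian_row_sum (p : nat) (G : 'M[R]_p) i : ct_interconnection G -> \sum_j G i j = 0.
Proof. by case=> _ Gd; rewrite (bigD1 i) //= Gd; apply: addNr. Qed.

(** Agents are rows, so that [G] acts on the left and [Q_t] on the right, with no Kronecker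
    product. *)
Definition deviation (n p : nat) (r : 'cV[R]_p) (x : 'I_p -> R -> 'cV[R]_n) (t : R) :
    'M[R]_(p, n) :=
  \matrix_(i < p, a < n) (x i t - kron_avg r (fun j => x j 0)) a ord0.

Lemma deviationE (n p : nat) (r : 'cV[R]_p) (x : 'I_p -> R -> 'cV[R]_n) t i a :
  deviation r x t i a = x i t a ord0 - \sum_j r j ord0 * x j 0 a ord0.
Proof.
rewrite mxE [LHS]mxE [X in _ + X]mxE summxE; congr (_ - _).
by apply: eq_bigr => j _; rewrite mxE.
Qed.

Section Deviation.
Variables (n p : nat) (Q : R -> 'M[R]_n) (G : 'M[R]_p) (r : 'cV[R]_p).
Variable x : 'I_p -> R -> 'cV[R]_n.
Hypothesis Q_le1 : forall t, 0 <= t -> symPSD_le1 (Q t).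
Hypothesis G_ic : ct_interconnection G.
Hypothesis x_sol : is_consensus_solution Q G x.

(** Zero row sums of [G] absorb both the term in [x i] and the common shift by the average; symmetry
    of [Q_t] moves it to the right. *)
Lemma deviation_speed t i a : 0 <= t ->
  (Q t *m (\sum_(j < p | j != i) G i j *: (x j t - x i t))) a ord0 =
  (G *m deviation r x t *m Q t) i a.
Proof.
move=> t0; have [QT _] := Q_psd Q_le1 t0.
rewrite [LHS]mxE [RHS]mxE; apply: eq_bigr => b _.
rewrite -[in RHS]QT [(Q t)^T _ _]mxE mulrC; congr (_ * _).
rewrite summxE [RHS]mxE.
set m := \sum_j r j ord0 * x j 0 b ord0.
transitivity (\sum_j G i j * (x j t b ord0 - x i t b ord0)).
  rewrite [RHS](bigD1 i) //= subrr mulr0 add0r; apply: eq_bigr => j _.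
  by rewrite mxE [X in _ * X]mxE [X in _ + X]mxE.
have z : \sum_j G i j * (x i t b ord0 - m) = 0.
  by rewrite -mulr_suml laplacian_row_sum // mul0r.
rewrite -[LHS]addr0 -[X in _ + X = _]z -big_split; apply: eq_bigr => j _ /=.
by rewrite deviationE -/m; ring.
Qed.

Lemma deviation_flow b i a :
  primitive_on (fun t => (G *m deviation r x t *m Q t) i a)
    (fun t => deviation r x t i a) 0 b.
Proof.
apply: primitive_on_of_origin => t t0.
have -> : Rminus (deviation r x t i a) (deviation r x 0 i a) =
    Rminus (x i t a ord0) (x i 0 a ord0).
  by rewrite !deviationE RminusE [RHS]RminusE; ring.
apply: is_RInt_ext (@x_sol i t t0 a) => q.
rewrite Rmin_left // => -[/RltP q0 _]; exact: deviation_speed (ltW q0).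
Qed.

Hypothesis rG : r^T *m G = 0.
Hypothesis r1 : \sum_i r i ord0 = 1.

(** [r^T Y] is conserved because [r^T G = 0], and it starts at [0] because [r] sums to [1]. *)
Lemma deviation_mean0 t : 0 <= t -> r^T *m deviation r x t = 0.
Proof.
move=> t0; apply/matrixP => k a; rewrite ord1.
pose phi s := \sum_i r i ord0 * deviation r x s i a.
have phiE s : (r^T *m deviation r x s) ord0 a = phi s.
  by rewrite mxE; apply: eq_bigr => i _; rewrite mxE.
rewrite phiE [RHS]mxE.
have phi0 : phi 0 = 0.
  rewrite /phi; under eq_bigr do rewrite deviationE mulrBr.
  by rewrite sumrB -mulr_suml r1 mul1r subrr.
have prim : primitive_on (fun s => \sum_i r i ord0 * (G *m deviation r x s *m Q s) i a) phi 0 t.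
  by apply: primitive_bigsum => i; apply: primitive_scale; apply: deviation_flow.
have I1 := prim 0 t (Rle_refl _) (elimT RleP t0) (Rle_refl _).
have I2 : is_RInt (fun s => \sum_i r i ord0 * (G *m deviation r x s *m Q s) i a) 0 t
    (scal (Rminus t 0) (0 : R_NormedModule)).
  apply: is_RInt_ext (is_RInt_const _ _ _) => s _.
  have : (r^T *m (G *m deviation r x s *m Q s)) ord0 a = 0.
    by rewrite !mulmxA rG !mul0mx mxE.
  rewrite mxE => sum0; rewrite -[LHS]sum0; apply: eq_bigr => i _.
  by rewrite [X in X * _]mxE.
have := is_RInt_unique _ _ _ _ I1; rewrite (is_RInt_unique _ _ _ _ I2).
rewrite phi0 /scal /= /mult /= Rmult_0_r => e.
by rewrite -[phi t]Rminus_0_r -e.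
Qed.

End Deviation.

Local Close Scope ring_scope.

Theorem theorem4 (n p : nat) (Q : R -> 'M[R]_n)
  (HQ : forall t : R, 0 <= t -> symPSD_le1 (Q t))
  (HQint : riemann_integrable_on_nonneg Q)
  (HQexc : sufficiently_exciting Q)
  (G : 'M[R]_p) (HG : ct_interconnection G) (Hconn : ic_connected G)
  (r : 'cV[R]_p)
  (Hr1 : (r^T *m G = 0)%R)
  (Hr2 : (\sum_(i < p) r i ord0 = 1)%R)
  (x : 'I_p -> R -> 'cV[R]_n)
  (Hx : is_consensus_solution Q G x) :
  forall i : 'I_p,
    is_lim (fun t => vnorm (x i t - kron_avg r (fun j => x j 0))%R) p_infty 0.
Proof.
have Q_le1 t : (0 <= t)%R -> symPSD_le1 (Q t) by move=> /RleP; apply: HQ.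
have [|||h0 [N [N0 mix]]] := laplacian_exp_limit (G := G) _ _ _ Hr1 Hr2.
- by move=> i j ij; apply/RleP; case: HG => Goff _; apply: Goff.
- by move=> i; apply: laplacian_row_sum.
- exact: Hconn.
move=> i; apply/is_lim_spec => eps.
have e0 : (0 < (eps : R))%R by apply/RltP/cond_pos.
(* The threshold is [eps ^+ 2], as [fnorm2] is a squared norm. *)
have [M hM] := flow_vanishes h0 N0 mix Q_le1 HQint
  (deviation_mean0 Q_le1 HG Hx Hr1 Hr2) (deviation_flow (r := r) Q_le1 HG Hx) HQexc
  (exprn_gt0 2 e0).
exists M => t /Rlt_le/RleP Mt; rewrite Rminus_0_r.
have v0 : (0 <= vnorm (x i t - kron_avg r (fun j => x j 0)))%R by rewrite vnormE sqrtr_ge0.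
rewrite RabsE ger0_norm //; apply/RltP.
rewrite -(ltr_pXn2r (n := 2)) ?nnegrE ?(ltW e0) //.
apply: le_lt_trans (hM t Mt).
rewrite vnormE sqr_sqrtr ?fnorm2_ge0 //.
(* The squared error of agent [i] is the contribution of row [i] to [fnorm2]. *)
rewrite [leRHS]fnorm2_rows (bigD1 i) //=.
rewrite -[leLHS]addr0; apply: lerD; last by apply: sumr_ge0 => k _; apply: fnorm2_ge0.
rewrite -fnorm2_tr le_eqVlt; apply/orP; left; apply/eqP; congr fnorm2.
by apply/matrixP => k a; rewrite !mxE ord1.
Qed.
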